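(* Let $N\ge 2$, and let $Q,B$ be real constant $N\times N$ matrices with $Q=Q^\star\ge 0$, such that $K(t)=\frac1t\int_0^t e^{sB}Qe^{sB^\star}ds$ is positive definite for every $t>0$. Let $\mathscr A u=\operatorname{tr}(Q\nabla^2u)+\langle BX,\nabla u\rangle$ be the associated operator on $\mathbb R^N$, with volume function $V(t)$, intrinsic dimensions $D_0$ (at zero) and $D_\infty$ (at infinity), Besov spaces $\mathfrak B^{\mathscr A}_{2s,1}$, seminorm $\mathscr N^{\mathscr A}_{2s,1}$ and $s$-perimeter $\mathfrak P_{\mathscr A,s}$ as defined in the context. Let $0<s<\frac12$, and assume $\operatorname{tr}B\ge0$ and $D_0>D_\infty$. Suppose there exists $\gamma>0$ such that $$V(t)\ge\gamma\min\{t^{D_0/2},t^{D_\infty/2}\}\qquad\text{for all }t>0.$$ Then $\mathfrak B^{\mathscr A}_{2s,1}\hookrightarrow L^{\frac{D_0}{D_0-2s}}+L^{\frac{D_\infty}{D_\infty-2s}}$. More precisely, there exists a constant $c>0$, depending only on $N,D_0,D_\infty,s,\gamma$, such that for every $f\in\mathfrak B^{\mathscr A}_{2s,1}$ one has $$\|f\|_{L^{\frac{D_0}{D_0-2s}}+L^{\frac{D_\infty}{D_\infty-2s}}}\le\frac1c\,\mathscr N^{\mathscr A}_{2s,1}(f).$$ Moreover, there exists a constant $\tilde c>0$, depending only on $N,D_0,D_\infty,s,\gamma$, such that for any measurable set $E\subset\mathbb R^N$ with $|E|<\infty$ one has $$\mathfrak P_{\mathscr A,s}(E)\ge\tilde 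c\,\min\left\{|E|^{\frac{D_0-2s}{D_0}},|E|^{\frac{D_\infty-2s}{D_\infty}}\right\}.$$
   Context: Lebesgue measure on $\mathbb R^N$ is denoted $|\cdot|$, $\omega_N$ is the Lebesgue measure of the unit ball of $\mathbb R^N$, $L^p=L^p(\mathbb R^N,dX)$, $X$ denotes the generic point of $\mathbb R^N$, and $B^\star$ is the transpose of $B$. Volume function: $V(t)=\omega_N\,(\det(tK(t)))^{1/2}$ for $t>0$. Intrinsic dimension at zero: it is known that there is a (unique) number $D_0\ge N$ such that $V(t)\cong t^{D_0/2}$ as $t\to0^+$ (i.e. the ratio $V(t)/t^{D_0/2}$ stays between two positive constants for small $t>0$); this number is $D_0$. Intrinsic dimension at infinity: $D_\infty=\sup\Sigma_\infty$, where $\Sigma_\infty=\left\{\alpha>0\;:\;\int_1^\infty\frac{t^{\frac\alpha2-1}}{V(t)}dt<\infty\right\}$. It is known that $2\le D_\infty\le\infty$ when $\operatorname{tr}B\ge0$. Heat kernel and semigroup: for $X,Y\in\mathbb R^N$ and $t>0$ let $m_t(X,Y)=\sqrt{\langle K(t)^{-1}(Y-e^{tB}X),Y-e^{tB}X\rangle}$ and $$p(X,Y,t)=\frac{\omega_N(4\pi)^{-N/2}}{V(t)}\exp\left(-\frac{m_t(X,Y)^2}{4t}\right),\qquad P_tf(X)=\int_{\mathbb R^N}p(X,Y,t)f(Y)\,dY.$$ Besov space: for $0<\alpha<1$ and $1\le p<\infty$, $\mathfrak B^{\mathscr A}_{\alpha,p}$ is the set of all $f\in L^p$ such that $$\mathscr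 N^{\mathscr A}_{\alpha,p}(f)=\left(\int_0^\infty\frac{1}{t^{\frac{\alpha p}{2}+1}}\int_{\mathbb R^N}P_t\left(|f-f(X)|^p\right)(X)\,dX\,dt\right)^{1/p}<\infty,$$ where $P_t(|f-f(X)|^p)(X)=\int_{\mathbb R^N}p(X,Y,t)|f(Y)-f(X)|^p\,dY$. $s$-perimeter: for $0<s<\frac12$ and $E\subset\mathbb R^N$ measurable, $E$ has finite $s$-perimeter if $\mathbf 1_E\in\mathfrak B^{\mathscr A}_{2s,1}$, and $\mathfrak P_{\mathscr A,s}(E)=\mathscr N^{\mathscr A}_{2s,1}(\mathbf 1_E)$, where $\mathbf 1_E$ is the indicator function of $E$. If $|E|<\infty$ and $\mathbf 1_E\notin\mathfrak B^{\mathscr A}_{2s,1}$ then $\mathfrak P_{\mathscr A,s}(E)=\mathscr N^{\mathscr A}_{2s,1}(\mathbf 1_E)=+\infty$. Sum space: $L^{q_0}+L^{q_\infty}$ is the Banach space of functions $f=f_1+f_2$ with $f_1\in L^{q_0}$, $f_2\in L^{q_\infty}$, with norm $\|f\|_{L^{q_0}+L^{q_\infty}}=\inf\{\|f_1\|_{q_0}+\|f_2\|_{q_\infty}: f=f_1+f_2,\ f_1\in L^{q_0},\ f_2\in L^{q_\infty}\}$. *)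

(* Defs.v *)
From HB Require Import structures.
From mathcomp Require Import all_boot all_order all_algebra.
From mathcomp Require Import all_classical all_reals all_analysis.

Set Implicit Arguments.
Unset Strict Implicit.
Unset Printing Implicit Defensive.
Import Order.TTheory GRing.Theory Num.Theory.
Import numFieldNormedType.Exports.

Local Open Scope classical_set_scope.
Local Open Scope ring_scope.

Section cons_measure.
Context {R : realType} {n : nat}.
Local Notation M := (measurableTypeR R).
Context (mu : {sigma_finite_measure set (n.-tuple M) -> \bar R}).
Local Open Scope ereal_scope.

Definition consT (z : M * n.-tuple M) : n.+1.-tuple M := [tuple of z.1 :: z.2].

Lemma measurable_consT : measurable_fun [set: M * n.-tuple M] consT.
Proof. exact: (measurable_cons measurable_fst measurable_snd). Qed.

Definition cons_measure : set (n.+1.-tuple M) -> \bar R :=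
  pushforward (lebesgue_measure \x mu) consT.

Let cons_measure0 : cons_measure set0 = 0.
Proof. by rewrite /cons_measure /pushforward preimage_set0 measure0. Qed.

Let cons_measure_ge0 A : 0 <= cons_measure A.
Proof. by rewrite /cons_measure /pushforward measure_ge0. Qed.

Let cons_measure_sigma_additive : semi_sigma_additive cons_measure.
Proof.
move=> F mF tF mUF; rewrite /cons_measure /pushforward preimage_bigcup.
have mpre (A : set (n.+1.-tuple M)) : measurable A ->
    measurable (consT @^-1` A).
  by move=> mA; rewrite -[X in measurable X]setTI; exact: measurable_consT.
apply: measure_semi_sigma_additive.
- by move=> k; exact: mpre.
- apply/trivIsetP => /= i j _ _ ij; rewrite -preimage_setI.
  by move/trivIsetP : tF => /(_ _ _ _ _ ij) ->//; rewrite preimage_set0.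
- by rewrite -preimage_bigcup; exact: mpre.
Qed.

HB.instance Definition _ := isMeasure.Build _ _ _ cons_measure
  cons_measure0 cons_measure_ge0 cons_measure_sigma_additive.

Let cons_measure_sigma_finite : sigma_finite setT cons_measure.
Proof.
have /sigma_finiteP[F [TF ndF Foo]] := sigma_finiteT (@lebesgue_measure R).
have /sigma_finiteP[G [TG ndG Goo]] := sigma_finiteT mu.
pose uncons (t : n.+1.-tuple M) := (thead t, [tuple of behead t]).
have muncons : measurable_fun [set: n.+1.-tuple M] uncons.
  apply/measurable_fun_pairP; split; first exact: measurable_tnth.
  exact: measurable_behead.
have consTK : cancel consT uncons.
  by move=> [x t]; rewrite /uncons/= theadE; congr (_, _); exact/val_inj.
exists (fun k => uncons @^-1` (F k `*` G k)).
  apply/seteqP; split=> [t _|//].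
  have : setT (uncons t).1 by []. rewrite TF => -[i _ Fi].
  have : setT (uncons t).2 by []. rewrite TG => -[j _ Gj].
  exists (maxn i j) => //; split.
  - by apply: (subsetPset _ _ (ndF _ _ (leq_maxl i j))).
  - by apply: (subsetPset _ _ (ndG _ _ (leq_maxr i j))).
move=> k; have [mFk Fkoo] := Foo k; have [mGk Gkoo] := Goo k; split.
  by rewrite -[X in measurable X]setTI; apply: muncons => //; exact: measurableX.
rewrite /cons_measure /pushforward -comp_preimage.
rewrite (_ : uncons \o consT = id); last exact/funext/consTK.
by rewrite preimage_id product_measure1E// lte_mul_pinfty// ge0_fin_numE.
Qed.

HB.instance Definition _ := Measure_isSigmaFinite.Build _ _ _ cons_measure
  cons_measure_sigma_finite.

End cons_measure.

(* n-fold product of the one-dimensional Lebesgue measure on the Borel sets. *)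
Fixpoint borel_lebesgue (R : realType) (n : nat) :
    {sigma_finite_measure set (n.-tuple (measurableTypeR R)) -> \bar R} :=
  if n is m.+1 then cons_measure (borel_lebesgue R m)
  else dirac [tuple].

Lemma borel_lebesgue_box (R : realType) (n : nat) (A : 'I_n -> set R) :
  (forall i, measurable (A i)) ->
  (borel_lebesgue R n [set x | forall i, A i (tnth x i)] =
  \prod_(i < n) lebesgue_measure (A i))%E.
Proof.
elim: n A => [A _|n IH A mA].
  by rewrite big_ord0 /= /dirac indicE mem_set//= => -[].
rewrite big_ord_recl -IH// /= /cons_measure /pushforward.
rewrite (_ : _ @^-1` _ =
  A ord0 `*` [set x | forall i, A (lift ord0 i) (tnth x i)]); last first.
  apply/seteqP; split => -[x t] /=.
    by move=> h; split=> [|i]; [have := h ord0|have := h (lift ord0 i); rewrite tnthS].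
  move=> [h0 hS] i; have [j ->|->//] := unliftP ord0 i.
  by rewrite tnthS.
have mB : measurable ([set x | forall i, A (lift ord0 i) (tnth x i)] :
    set (n.-tuple (measurableTypeR R))).
  rewrite [X in measurable X](_ : _ =
      \bigcap_i ((@tnth n (measurableTypeR R) ^~ i) @^-1` (A (lift ord0 i)))).
    apply: fin_bigcap_measurable => // i _.
    by rewrite -[X in measurable X]setTI; apply: measurable_tnth => //; exact: mA.
  by apply/seteqP; split => t /= h i; [move=> _; exact: h|exact: (h i)].
by rewrite product_measure1E//; exact: mA.
Qed.

(* R^N with the sigma-algebra of Lebesgue measurable sets, i.e. the Caratheodory
   sets of the outer measure of the N-fold Borel product measure. *)
Definition Rn (R : realType) (N : nat) : measurableType _ :=
  caratheodory_type (mu_ext (borel_lebesgue R N)).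

Definition lebesgue_Rn (R : realType) (N : nat) :
    {measure set (Rn R N) -> \bar R} :=
  @completed_measure_extension _ _ _ (borel_lebesgue R N).

Definition colv (R : realType) (N : nat) (X : Rn R N) : 'cV[R]_N :=
  \col_i (tnth X i : R).

Definition dotv (R : realType) (N : nat) (u v : 'cV[R]_N) : R :=
  \sum_i u i 0 * v i 0.

Definition unit_ball (R : realType) (N : nat) : set (Rn R N) :=
  [set X | dotv (colv X) (colv X) < 1].

Definition omega (R : realType) (N : nat) : R :=
  fine (lebesgue_Rn R N (@unit_ball R N)).

Definition psdmx (R : realType) (N : nat) (M : 'M[R]_N) : Prop :=
  forall u : 'cV[R]_N, 0 <= dotv (M *m u) u.

Definition pdmx (R : realType) (N : nat) (M : 'M[R]_N) : Prop :=
  forall u : 'cV[R]_N, u != 0 -> 0 < dotv (M *m u) u.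

Definition expmx (R : realType) (N : nat) (A : 'M[R]_N) : 'M[R]_N :=
  limn (series (fun k : nat => (k`!%:R)^-1 *: A ^+ k)).

(* The operator tr(Q Hess u) + <BX, grad u> enters only through (Q, B), so every
   notion attached to it below is parameterized by these two matrices. *)
Definition Kmx (R : realType) (N : nat) (Q B : 'M[R]_N) (t : R) : 'M[R]_N :=
  t^-1 *: \matrix_(i, j) \int[lebesgue_measure]_(r in `[0, t])
    ((expmx (r *: B) *m Q *m expmx (r *: B^T)) i j).

Definition vol (R : realType) (N : nat) (Q B : 'M[R]_N) (t : R) : R :=
  omega R N * Num.sqrt (\det (t *: Kmx Q B t)).

(* "D0 is the intrinsic dimension at zero of (Q, B)"; such a D0 is unique. *)
Definition dim_zero (R : realType) (N : nat) (Q B : 'M[R]_N) (D0 : R) : Prop :=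
  N%:R <= D0 /\
  exists c C : R, [/\ 0 < c, 0 < C &
    \forall t \near 0^'+, c <= vol Q B t / t `^ (D0 / 2) <= C].

Definition Sigma_infty (R : realType) (N : nat) (Q B : 'M[R]_N) : set R :=
  [set a | 0 < a /\
    (\int[lebesgue_measure]_(t in `[1%R, +oo[)
       ((t `^ (a / 2 - 1) / vol Q B t)%R)%:E < +oo)%E].

Definition dim_infty (R : realType) (N : nat) (Q B : 'M[R]_N) : \bar R :=
  ereal_sup [set a%:E | a in Sigma_infty Q B].

Definition kernel_dist (R : realType) (N : nat) (Q B : 'M[R]_N) (t : R)
    (X Y : Rn R N) : R :=
  let v := colv Y - expmx (t *: B) *m colv X in
  Num.sqrt (dotv (invmx (Kmx Q B t) *m v) v).

Definition heat_kernel (R : realType) (N : nat) (Q B : 'M[R]_N)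
    (X Y : Rn R N) (t : R) : R :=
  omega R N * (4 * pi) `^ (- (N%:R / 2)) / vol Q B t *
  expR (- (kernel_dist Q B t X Y ^+ 2 / (4 * t))).

Definition heat_semigroup (R : realType) (N : nat) (Q B : 'M[R]_N) (t : R)
    (g : Rn R N -> R) (X : Rn R N) : \bar R :=
  (\int[lebesgue_Rn R N]_Y (heat_kernel Q B X Y t * g Y)%:E)%E.

Definition besov_seminorm (R : realType) (N : nat) (Q B : 'M[R]_N)
    (alpha p : R) (f : Rn R N -> R) : \bar R :=
  ((\int[lebesgue_measure]_(t in `]0%R, +oo[)
     (((t `^ (alpha * p / 2 + 1))^-1)%:E *
      \int[lebesgue_Rn R N]_X
        heat_semigroup Q B t (fun Y => `|f Y - f X| `^ p)%R X)) `^ p^-1)%E.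

Definition besov (R : realType) (N : nat) (Q B : 'M[R]_N) (alpha p : R) :
    set (Rn R N -> R) :=
  [set f | f \in Lfun (lebesgue_Rn R N) p%:E /\
           (besov_seminorm Q B alpha p f < +oo)%E].

(* The value +oo is taken exactly when the indicator of E, supposed integrable,
   is not in the Besov space. *)
Definition perimeter (R : realType) (N : nat) (Q B : 'M[R]_N) (s : R)
    (E : set (Rn R N)) : \bar R :=
  besov_seminorm Q B (2 * s) 1 (\1_E).

Definition sum_decomposition (R : realType) (N : nat) (q0 q1 : R)
    (f : Rn R N -> R) : set ((Rn R N -> R) * (Rn R N -> R)) :=
  [set g | [/\ g.1 \in Lfun (lebesgue_Rn R N) q0%:E,
               g.2 \in Lfun (lebesgue_Rn R N) q1%:E &
               f = g.1 \+ g.2 %[ae lebesgue_Rn R N]]].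

Definition sum_space (R : realType) (N : nat) (q0 q1 : R) :
    set (Rn R N -> R) :=
  [set f | sum_decomposition q0 q1 f !=set0].

Definition sum_norm (R : realType) (N : nat) (q0 q1 : R) (f : Rn R N -> R) :
    \bar R :=
  ereal_inf [set ('N[lebesgue_Rn R N]_(q0%:E)[EFin \o g.1] +
                  'N[lebesgue_Rn R N]_(q1%:E)[EFin \o g.2])%E
            | g in sum_decomposition q0 q1 f].

(* Main.v *)
From HB Require Import structures.
Require Import Defs.
From mathcomp Require Import all_boot all_order all_fingroup all_algebra.
From mathcomp Require Import all_classical all_reals all_analysis.
From mathcomp Require Import measurable_realfun.
From mathcomp Require Import ring lra.

(* The heat kernel p(X, ., t) is a probability density bounded by kappa / V(t).
   Hence, for g >= 0 and a level l with |{g > l}| <= V(t) / (2 kappa), at each X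
   with g(X) >= 2 l the kernel puts mass at least 1/2 on {g <= l}, and
   \int p(X, Y, t) |g(Y) - g(X)| dY >= g(X) / 4.  If V(t) >= c t^(D/2) on the
   relevant range of times and J = \int g^q with q = D / (D - 2 s), Chebyshev's
   inequality shows that l ~ (J / t^(D/2))^(1/q) is admissible at time t;
   integrating against t^(-s-1) dt, in time first, gives
   \int g^q J^(-(q-1)/q) <= C N(g), that is |g|_q <= C N(g), with no coarea
   formula.  For D_0 > D_infty one splits f at the level where its distribution
   function crosses gamma / (2 kappa): the part above the level only sees D_0, the
   part below only D_infty.  Indicators give the isoperimetric inequality.

   The exponents make sense because D_infty >= 1 > 2 s: t K(t) = C(t) satisfies
   C(2t) = C(t) + e^(tB) C(t) e^(tB)^T with det e^(tB) >= 1, and comparing Gaussian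
   integrals yields det C(2t) >= 2^N det C(t), so V grows at least linearly. *)

Set Implicit Arguments.
Unset Strict Implicit.
Unset Printing Implicit Defensive.
Import Order.TTheory GRing.Theory Num.Theory.
Import numFieldNormedType.Exports.

Local Open Scope classical_set_scope.
Local Open Scope ring_scope.

(** * Nonlocal seminorms of a bounded Markov kernel *)

Lemma powR_mono_le (R : realType) (r x y : R) : 0 < r -> 0 <= x -> 0 <= y ->
  (x `^ r <= y `^ r) = (x <= y).
Proof.
move=> r0 x0 y0; have [xy|yx] := leP x y.
  by apply: ge0_ler_powR => //; rewrite ltW.
by apply/negbTE; rewrite -ltNge gt0_ltr_powR.
Qed.

Lemma min_lipschitz (R : realDomainType) (u v c : R) :
  `|Num.min u c - Num.min v c| <= `|u - v|.
Proof.
have [uv|vu] := ger0P (u - v); rewrite ler_norml;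
  by case: (leP u c) => uc; case: (leP v c) => vc; apply/andP; split; lra.
Qed.

Section integral_monotone.
Context (d : measure_display) (T : measurableType d) (R : realType).
Variable mu : {measure set T -> \bar R}.
Local Open Scope ereal_scope.

(* Unlike [ge0_le_integral], no measurability is needed: the integral of a
   nonnegative function is a supremum over the simple functions below it. *)
Lemma ge0_le_integral_nomeas (D : set T) (f g : T -> \bar R) :
  (forall x, D x -> 0 <= f x) -> (forall x, D x -> f x <= g x) ->
  \int[mu]_(x in D) f x <= \int[mu]_(x in D) g x.
Proof.
move=> f0 fg; have g0 x : D x -> 0 <= g x.
  by move=> Dx; apply: le_trans (fg _ Dx); exact: f0.
rewrite !ge0_integralE//; apply: ge_ereal_sup => _ [h hf <-].
apply: ereal_sup_ubound; exists h => // x; apply: le_trans (hf x) _.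
by rewrite /patch; case: ifPn => // /set_mem; exact: fg.
Qed.

Lemma ge0_chebyshev (g : T -> R) (q l : R) :
  measurable_fun setT g -> (forall x, 0 <= g x)%R -> (0 < q)%R -> (0 < l)%R ->
  (l `^ q)%:E * mu [set x | (l < g x)%R] <= \int[mu]_x (g x `^ q)%:E.
Proof.
move=> mg g0 q0 l0.
have mE : measurable [set x | (l < g x)%R].
  rewrite -[X in measurable X]setTI (_ : [set x | _] = g @^-1` `]l, +oo[).
    by apply: mg => //; exact: measurable_itv.
  by apply/seteqP; split => x /=; rewrite in_itv/= andbT.
rewrite -[X in _ * mu X]setIT -integral_indic// -ge0_integralZl_EFin//; last 2 first.
- by apply/measurable_EFinP; exact: measurable_indic.
- exact: powR_ge0.
apply: ge0_le_integral_nomeas => x _.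
  by rewrite -EFinM lee_fin mulr_ge0// powR_ge0.
rewrite -EFinM lee_fin indicE; case: (boolP (x \in _)) => [|_].
  rewrite inE/= mulr1 => lg.
  by apply: ge0_ler_powR; rewrite ?nnegrE ?(ltW q0) ?(ltW l0) ?g0// ltW.
by rewrite mulr0 powR_ge0.
Qed.

End integral_monotone.

(** * Embedding with a single exponent *)

Section nonlocal_seminorm.
Context (d : measure_display) (T : measurableType d) (R : realType).
Variable mu : {sigma_finite_measure set T -> \bar R}.
Variables (p : R -> T -> T -> R) (b : R -> R).
Hypothesis p_ge0 : forall (t : R) x y, 0 < t -> 0 <= p t x y.
Hypothesis p_meas : forall (t : R) x, 0 < t -> measurable_fun setT (p t x).
Hypothesis p_int : forall (t : R) x, 0 < t -> (\int[mu]_y (p t x y)%:E = 1)%E.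
Hypothesis p_le : forall (t : R) x y, 0 < t -> p t x y <= b t.

(** The Besov seminorm with [p = 1] and [alpha = 2 s], for a general kernel: the exponent
    [alpha p / 2 + 1] of the weight becomes [s + 1]. *)
Definition nonlocal_seminorm (s : R) (f : T -> R) : \bar R :=
  (\int[lebesgue_measure]_(t in `]0%R, +oo[)
     (((t `^ (s + 1))^-1)%:E *
      \int[mu]_x \int[mu]_y (p t x y * `|f y - f x|)%:E))%E.

Let inner_ge0 (t : R) x (f : T -> R) : 0 < t ->
  (0 <= \int[mu]_y (p t x y * `|f y - f x|)%:E)%E.
Proof.
by move=> t0; apply: integral_ge0 => y _; rewrite lee_fin mulr_ge0// p_ge0.
Qed.

Lemma nonlocal_seminorm_ge0 s f : (0 <= nonlocal_seminorm s f)%E.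
Proof.
apply: integral_ge0 => t; rewrite /= in_itv/= andbT => t0.
apply: mule_ge0; first by rewrite lee_fin invr_ge0 powR_ge0.
by apply: integral_ge0 => x _; exact: inner_ge0.
Qed.

(** Meant for truncations and absolute values of [g], which are 1-Lipschitz functions of it. *)
Lemma le_nonlocal_seminorm s (f g : T -> R) :
  (forall x y, `|f y - f x| <= `|g y - g x|) ->
  (nonlocal_seminorm s f <= nonlocal_seminorm s g)%E.
Proof.
move=> fg; apply: ge0_le_integral_nomeas => t; rewrite /= in_itv/= andbT => t0.
  apply: mule_ge0; first by rewrite lee_fin invr_ge0 powR_ge0.
  by apply: integral_ge0 => x _; exact: inner_ge0.
apply: lee_wpmul2l; first by rewrite lee_fin invr_ge0 powR_ge0.
apply: ge0_le_integral_nomeas => x _; first exact: inner_ge0.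
apply: ge0_le_integral_nomeas => y _; first by rewrite lee_fin mulr_ge0// p_ge0.
by rewrite lee_fin; apply: ler_wpM2l; [exact: p_ge0|exact: fg].
Qed.

(* At a point where [g] exceeds twice the level [l], the kernel puts mass at
   least [1/2] on the set where [g <= l]. *)
Lemma inner_ge (g : T -> R) (t l : R) x : 0 < t ->
  measurable_fun setT g -> (forall x, 0 <= g x) ->
  ((b t)%:E * mu [set x | (l < g x)%R] <= (2^-1)%:E)%E -> 2 * l <= g x ->
  ((g x / 4)%:E <= \int[mu]_y (p t x y * `|g y - g x|)%:E)%E.
Proof.
move=> t0 mg g0 bl lx.
set E := [set x | (l < g x)%R] in bl *.
have mE : measurable E.
  rewrite -[X in measurable X]setTI (_ : E = g @^-1` `]l, +oo[).
    by apply: mg => //; exact: measurable_itv.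
  by apply/seteqP; split => y /=; rewrite /E/= in_itv/= andbT.
have mp : measurable_fun setT (fun y => (p t x y)%:E).
  by apply/measurable_EFinP; exact: p_meas.
have pE : (\int[mu]_(y in E) (p t x y)%:E <= (2^-1)%:E)%E.
  apply: le_trans bl; rewrite -(integral_cst mu mE).
  apply: ge0_le_integral_nomeas => y _; first by rewrite lee_fin p_ge0.
  by rewrite lee_fin p_le.
have pEC : ((2^-1)%:E <= \int[mu]_(y in ~` E) (p t x y)%:E)%E.
  have := p_int x t0; rewrite -(setUv E) ge0_integral_setU//; last 4 first.
  - exact: measurableC.
  - by rewrite setUv.
  - by move=> y _; rewrite lee_fin p_ge0.
  - by apply/disj_setPCl.
  move=> h; have : ((2^-1)%:E + (2^-1)%:E <=
      (2^-1)%:E + \int[mu]_(y in ~` E) (p t x y)%:E)%E.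
    rewrite (_ : (2^-1)%:E + (2^-1)%:E = 1)%E; last by rewrite -EFinD; congr EFin; lra.
    by rewrite -h; exact: leeD.
  by rewrite leeD2lE.
(* Off [E] one has [g y <= l <= g x / 2], so the difference is at least [g x / 2]; a mass of at
   least 1/2 then gives [g x / 4]. *)
apply: (@le_trans _ _ ((g x / 2)%:E * \int[mu]_(y in ~` E) (p t x y)%:E)%E).
  apply: (@le_trans _ _ ((g x / 2)%:E * (2^-1)%:E)%E).
    by rewrite -EFinM lee_fin; have := g0 x; lra.
  by apply: lee_pmul => //; rewrite lee_fin// divr_ge0.
rewrite -ge0_integralZl_EFin//; last 4 first.
- exact: measurableC.
- by move=> y _; rewrite lee_fin p_ge0.
- exact: measurable_funTS.
- by rewrite divr_ge0.
rewrite integral_mkcond; apply: ge0_le_integral_nomeas => y _.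
  rewrite /patch; case: ifPn => // _.
  by rewrite -EFinM lee_fin mulr_ge0 ?divr_ge0 ?p_ge0.
rewrite /patch; case: ifPn => [|_]; last first.
  by rewrite lee_fin mulr_ge0// p_ge0.
rewrite inE /E/= => /negP; rewrite -leNgt => gyl.
rewrite -EFinM lee_fin mulrC; apply: ler_wpM2l; first exact: p_ge0.
rewrite distrC ler_normr; apply/orP; left; lra.
Qed.

(** The time integral over [[t1, 2 t1]] produces [2^(-(s+1)) / 4 * g * t1^(-s)]. With
    [t1 = (a J 2^q g^(-q))^(2/D)] and [q = D / (D - 2 s)] this is [embedding_const] times
    [J^(-2s/D) g^q]. *)
Definition embedding_const (a D s : R) : R :=
  2 `^ (- (s + 1)) / 4 * (a * 2 `^ (D / (D - 2 * s))) `^ (- (2 * s / D)).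

Lemma embedding_const_gt0 a D s : 0 < a -> 0 < embedding_const a D s.
Proof.
move=> a0; rewrite /embedding_const mulr_gt0 ?divr_gt0 ?powR_gt0//.
by rewrite mulr_gt0// powR_gt0.
Qed.

(* With [J = \int g^q], Chebyshev's inequality makes the level
   [(a J / t^(D/2))^(1/q)] admissible at time [t]; it lies below [g x / 2] as
   soon as [t >= t1 x], and integrating in time over [t1 x, 2 t1 x] before
   integrating in space returns [J] up to the power of [J] in [t1]. *)
Lemma nonlocal_embedding_finite (g : T -> R) (D s a J : R) :
  let q := D / (D - 2 * s) in
  0 < s -> 2 * s < D -> 0 < a -> 0 < J ->
  measurable_fun setT g -> (forall x, 0 <= g x) ->
  (forall l t : R, 0 < l -> 0 < t ->
     (a%:E * mu [set x | (l < g x)%R] <= (t `^ (D / 2))%:E)%E ->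
     ((b t)%:E * mu [set x | (l < g x)%R] <= (2^-1)%:E)%E) ->
  (\int[mu]_x (g x `^ q)%:E = J%:E)%E ->
  ((embedding_const a D s * J `^ q^-1)%:E <= nonlocal_seminorm s g)%E.
Proof.
move=> q s0 sD a0 J0 mg g0 H gJ.
have D0 : 0 < D by lra.
have Ds0 : 0 < D - 2 * s by lra.
have q0 : 0 < q by rewrite divr_gt0.
set c0 := a * J * 2 `^ q.
have c00 : 0 < c0 by rewrite !mulr_gt0// powR_gt0.
(* Solution [t] of [a J / t^(D/2) = (g x / 2)^q], the time at which the level [l] equals
   [g x / 2]. *)
pose t1 x := (c0 * g x `^ (- q)) `^ (2 / D).
have t1_gt0 x : 0 < g x -> 0 < t1 x.
  by move=> gx0; rewrite powR_gt0// mulr_gt0// powR_gt0.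
have level x (t : R) : 0 < g x -> 0 < t -> t1 x <= t ->
    ((g x / 4)%:E <= \int[mu]_y (p t x y * `|g y - g x|)%:E)%E.
  move=> gx0 t0 t1t.
  have tD0 : 0 < t `^ (D / 2) by rewrite powR_gt0.
  have k0 : 0 < a * J / t `^ (D / 2) by rewrite divr_gt0 ?mulr_gt0.
  pose l := (a * J / t `^ (D / 2)) `^ q^-1.
  have l0 : 0 < l by rewrite powR_gt0.
  have lq : l `^ q = a * J / t `^ (D / 2).
    by rewrite /l -powRrM mulVf ?gt_eqF// powRr1// ltW.
  apply: (@inner_ge _ _ l) => //.
    apply: H => //.
    have : ((l `^ q)%:E * mu [set x | (l < g x)%R] <= J%:E)%E.
      by rewrite -gJ; exact: ge0_chebyshev.
    have : (0 <= mu [set x | (l < g x)%R])%E by exact: measure_ge0.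
    rewrite lq; move: (mu _) => [r| |]//.
    - move=> _; rewrite -!EFinM !lee_fin.
      rewrite (_ : a * J / t `^ (D / 2) * r = J * (a * r / t `^ (D / 2))).
        by rewrite ger_pMr// ler_pdivrMr// mul1r.
      by field; rewrite gt_eqF.
    (* A level set of infinite measure would contradict Chebyshev's bound by the finite [J]. *)
    - by rewrite gt0_muley ?lte_fin// leye_eq.
  have lx : l <= g x / 2.
    rewrite -(@powR_mono_le _ q) ?(ltW l0) ?divr_ge0//.
    have -> : (g x / 2) `^ q = g x `^ q / 2 `^ q.
      by rewrite powRM// -(powR_inv1 (ler0n R 2)) -powRrM mulN1r powRN.
    rewrite lq ler_pdivrMr// mulrAC ler_pdivlMr ?powR_gt0//.
    have : c0 * g x `^ (- q) <= t `^ (D / 2).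
      have : t1 x `^ (D / 2) <= t `^ (D / 2).
        by rewrite powR_mono_le ?divr_gt0 ?(ltW t0) ?powR_ge0.
      rewrite /t1 -powRrM (_ : 2 / D * (D / 2) = 1) ?powRr1//; last by field; rewrite gt_eqF.
      by rewrite mulr_ge0 ?powR_ge0 ?(ltW c00).
    by rewrite powRN ler_pdivrMr ?powR_gt0// [t `^ _ * _]mulrC.
  by clear -lx; lra.
(* Jointly measurable minorant of the integrand: for [t1 x <= t <= 2 t1 x] the weight [t^(-(s+1))]
   is at least its value at [2 t1 x]. Where [g] vanishes, so does [h]. *)
pose h (z : measurableTypeR R * T) : R :=
  (g z.2 / 4 * (2 * t1 z.2) `^ (- (s + 1))) *
  (if (t1 z.2 <= z.1) && (z.1 <= 2 * t1 z.2) then 1 else 0).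
have mt1 : measurable_fun setT t1.
  apply: measurableT_comp (measurable_powR _) _.
  apply: measurable_funM => //.
  exact: measurableT_comp (measurable_powR _) mg.
have mphi : measurable_fun setT
    (fun x => g x / 4 * (2 * t1 x) `^ (- (s + 1))).
  apply: measurable_funM; first by apply: measurable_funM.
  by apply: measurableT_comp (measurable_powR _) _; exact: measurable_funM.
have mh : measurable_fun setT (fun z => (h z)%:E).
  apply/measurable_EFinP; apply: measurable_funM.
    exact: measurableT_comp mphi measurable_snd.
  apply: measurable_fun_ifT => //; apply: measurable_and.
    apply: measurable_fun_ler; last exact: measurable_fst.
    exact: measurableT_comp mt1 measurable_snd.
  apply: measurable_fun_ler; first exact: measurable_fst.
  apply: measurable_funM; first exact: measurable_cst.
  exact: measurableT_comp mt1 measurable_snd.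
have h0 z : (0 <= (h z)%:E)%E.
  rewrite lee_fin; apply: mulr_ge0; last by case: ifP.
  by rewrite mulr_ge0 ?divr_ge0 ?powR_ge0.
have t1_ge0 x : 0 <= t1 x by exact: powR_ge0.
(* By Tonelli's theorem time is integrated first. The interval has length [t1 x], so the inner
   integral is a constant times [g x ^ q], and the space integral returns [J]. *)
apply: (@le_trans _ _ (\int[lebesgue_measure]_t \int[mu]_x (h (t, x))%:E)%E).
  rewrite (@fubini_tonelli _ _ _ _ _ lebesgue_measure mu _ mh h0).
  rewrite [leRHS](_ : _ = (\int[mu]_x ((2 `^ (- (s + 1)) / 4 * c0 `^ (- (2 * s / D)))%:E *
      (g x `^ q)%:E))%E); last first.
    apply: eq_integral => x _; rewrite /h/=.
    set k := g x / 4 * _.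
    transitivity (\int[lebesgue_measure]_(t in `[t1 x, (2 * t1 x)%R]) cst k%:E t)%E.
      rewrite [RHS]integral_mkcond; apply: eq_integral => t _; rewrite /patch.
      have -> : (t \in [set` `[t1 x, 2 * t1 x]]) = (t1 x <= t) && (t <= 2 * t1 x).
        by apply/idP/idP; rewrite inE/= in_itv/=.
      by case: ifP => _; rewrite ?mulr1 ?mulr0.
    rewrite integral_cst; last exact: measurable_itv.
    rewrite /= lebesgue_measure_itv/= lte_fin.
    have [gx|gx] := eqVneq (g x) 0.
      by rewrite /k gx !mul0r mul0e powR0 ?mule0// gt_eqF.
    have gx0 : 0 < g x by rewrite lt_neqAle eq_sym gx g0.
    have t1x := t1_gt0 _ gx0.
    rewrite ifT; last by lra.
    rewrite (_ : (2 * t1 x)%:E - (t1 x)%:E = (t1 x)%:E)%E; last first.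
      by apply: (congr1 EFin); ring.
    apply: (congr1 EFin); rewrite /k powRM//.
    have -> : t1 x `^ (- (s + 1)) = t1 x `^ (- s) / t1 x.
      rewrite opprD powRD; last by apply/implyP => _; rewrite gt_eqF.
      by rewrite powR_inv1// ltW.
    have -> : t1 x `^ (- s) = c0 `^ (- (2 * s / D)) * g x `^ (q - 1).
      rewrite /t1 -powRrM powRM ?powR_ge0 ?(ltW c00)// -powRrM.
      congr (_ `^ _ * _ `^ _); rewrite /q; field; rewrite !gt_eqF//.
    have -> : g x `^ q = g x `^ (q - 1) * g x.
      by rewrite -[in RHS](powRr1 (ltW gx0)) -powRrM mul1r -powRD ?subrK// gx implybT.
    by field; rewrite gt_eqF.
  rewrite ge0_integralZl_EFin//; last 3 first.
  - by move=> x _; rewrite lee_fin powR_ge0.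
  - by apply/measurable_EFinP; exact: measurableT_comp (measurable_powR _) mg.
  - by rewrite mulr_ge0 ?divr_ge0 ?powR_ge0.
  rewrite gJ -EFinM lee_fin /embedding_const -/q.
  have -> : c0 = a * 2 `^ q * J by rewrite /c0 mulrAC.
  rewrite [in leRHS]powRM ?mulr_ge0 ?powR_ge0 ?(ltW a0) ?(ltW J0)//.
  rewrite -!mulrA; do !apply: ler_wpM2l; rewrite ?powR_ge0 ?invr_ge0//.
  rewrite -[in leRHS](powRr1 (ltW J0)) -powRrM mul1r -powRD; last first.
    by apply/implyP => _; rewrite gt_eqF.
  rewrite (_ : - _ + 1 = q^-1)// /q; field; rewrite !gt_eqF//.
(* The function [h] vanishes for [t <= 0], because [t1 x > 0] wherever [g x > 0]. *)
rewrite [leLHS](_ : _ =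
  \int[lebesgue_measure]_(t in `]0%R, +oo[) \int[mu]_x (h (t, x))%:E)%E; last first.
  rewrite [RHS]integral_mkcond; apply: eq_integral => t _.
  rewrite /patch; case: ifPn => //; rewrite notin_setE/= in_itv/= andbT => /negP.
  rewrite -leNgt => t0; apply: integral0_eq => x _; congr EFin; rewrite /h/=.
  have [->|gx] := eqVneq (g x) 0; first by rewrite !mul0r.
  case: ifP => [/andP[t1t _]|]; last by rewrite mulr0.
  have : 0 < t1 x by apply: t1_gt0; rewrite lt_neqAle eq_sym gx g0.
  by move/lt_le_trans => /(_ _ t1t); rewrite ltNge t0.
apply: ge0_le_integral_nomeas => t; rewrite /= in_itv/= andbT => t0.
  by apply: integral_ge0 => x _; exact: h0.
(* The weight is moved across the space integral on the measurable [G], as nothing is assumed on the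
   measurability in [x] of the inner kernel integral that [G] bounds from below. *)
pose G x := if t1 x <= t then g x / 4 else 0.
have G0 x : (0 <= (G x)%:E)%E by rewrite lee_fin /G; case: ifP; rewrite ?divr_ge0.
have mG : measurable_fun setT (fun x => (G x)%:E).
  apply/measurable_EFinP; apply: measurable_fun_ifT => //.
    exact: measurable_fun_ler.
  exact: measurable_funM.
apply: (@le_trans _ _ (((t `^ (s + 1))^-1)%:E * \int[mu]_x (G x)%:E)%E).
  rewrite -ge0_integralZl_EFin//; last by rewrite invr_ge0 powR_ge0.
  apply: ge0_le_integral_nomeas => x _; first exact: h0.
  rewrite -EFinM lee_fin /h /G/=.
  case: ifPn => [/andP[t1t tt1]|_]; last first.
    by rewrite mulr0 mulr_ge0 ?invr_ge0 ?powR_ge0//; case: ifP; rewrite ?divr_ge0.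
  rewrite t1t mulr1 mulrC; apply: ler_wpM2r; first by rewrite divr_ge0.
  rewrite powRN lef_pV2 ?posrE ?powR_gt0//; last exact: lt_le_trans tt1.
  by apply: ge0_ler_powR; rewrite ?nnegrE ?addr_ge0 ?(ltW s0)// ltW// (lt_le_trans t0).
apply: lee_wpmul2l; first by rewrite lee_fin invr_ge0 powR_ge0.
apply: ge0_le_integral_nomeas => x _ //; rewrite /G.
case: ifP => [t1t|_]; last exact: inner_ge0.
have [gx|gx] := eqVneq (g x) 0; first by rewrite {1}gx mul0r; exact: inner_ge0.
by apply: level; rewrite // lt_neqAle eq_sym gx g0.
Qed.

(** Truncating [g] at height [n] makes [J] finite and does not increase the seminorm. The level sets
    of the truncation are those of [g] or empty, so the level hypothesis persists. The resulting
    bound is uniform in [n], and monotone convergence removes the truncation. *)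
Lemma nonlocal_embedding (g : T -> R) (D s a : R) :
  let q := D / (D - 2 * s) in
  0 < s -> 2 * s < D -> 0 < a ->
  measurable_fun setT g -> (forall x, 0 <= g x) ->
  (\int[mu]_x (g x)%:E < +oo)%E ->
  (forall l t : R, 0 < l -> 0 < t ->
     (a%:E * mu [set x | (l < g x)%R] <= (t `^ (D / 2))%:E)%E ->
     ((b t)%:E * mu [set x | (l < g x)%R] <= (2^-1)%:E)%E) ->
  ((embedding_const a D s)%:E * 'N[mu]_(q%:E)[EFin \o g]
     <= nonlocal_seminorm s g)%E.
Proof.
move=> q s0 sD a0 mg g0 gfin H.
have q0 : 0 < q by rewrite divr_gt0//; lra.
have q1 : 1 <= q by rewrite /q ler_pdivlMr ?mul1r; lra.
have K0 := embedding_const_gt0 D s a0.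
set K := embedding_const a D s in K0 *.
have := nonlocal_seminorm_ge0 s g.
case Nr : (nonlocal_seminorm s g) => [r| |]//; last by move=> _; exact: leey.
rewrite lee_fin => r0.
pose gn (n : nat) x := Num.min (g x) n%:R.
have gn0 n x : 0 <= gn n x by rewrite le_min g0 ler0n.
have mgn n : measurable_fun setT (gn n) by exact: measurable_minr.
have mgnq n : measurable_fun setT (fun x => (gn n x `^ q)%:E).
  by apply/measurable_EFinP; exact: measurableT_comp (measurable_powR _) (mgn n).
have In n : (\int[mu]_x (gn n x `^ q)%:E <= ((r / K) `^ q)%:E)%E.
  (* Since [q >= 1] and [gn n <= n], the power is at most [n^(q-1) g], which is integrable. *)
  have Ifin : (\int[mu]_x (gn n x `^ q)%:E < +oo)%E.
    apply: (@le_lt_trans _ _ (\int[mu]_x ((n%:R `^ (q - 1))%:E * (g x)%:E))%E).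
      apply: ge0_le_integral_nomeas => x _; first by rewrite lee_fin powR_ge0.
      rewrite -EFinM lee_fin.
      have [->|gnx] := eqVneq (gn n x) 0.
        by rewrite powR0 ?gt_eqF// mulr_ge0// powR_ge0.
      have -> : gn n x `^ q = gn n x `^ (q - 1) * gn n x.
        by rewrite -[in RHS](powRr1 (gn0 n x)) -powRrM mul1r -powRD ?subrK// gnx implybT.
      apply: ler_pM => //; rewrite ?powR_ge0//.
        by apply: ge0_ler_powR; rewrite ?nnegrE ?gn0 ?subr_ge0// ge_min lexx orbT.
      by rewrite ge_min lexx.
    rewrite ge0_integralZl_EFin ?powR_ge0//.
    - by apply: lte_mul_pinfty => //; rewrite lee_fin powR_ge0.
    - by move=> x _; rewrite lee_fin.
    - exact/measurable_EFinP.
  have : (0 <= \int[mu]_x (gn n x `^ q)%:E)%E.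
    by apply: integral_ge0 => x _; rewrite lee_fin powR_ge0.
  case IJ : (\int[mu]_x (gn n x `^ q)%:E)%E Ifin => [J| |]// _.
  rewrite !lee_fin le_eqVlt => /predU1P[<-|J0]; first exact: powR_ge0.
  have : ((K * J `^ q^-1)%:E <= nonlocal_seminorm s (gn n))%E.
    apply: nonlocal_embedding_finite => // l t l0 t0.
    have [ln|nl] := ltP l n%:R.
      have -> : [set x | l < gn n x] = [set x | l < g x].
        by apply/seteqP; split => x /=; rewrite lt_min ln andbT.
      exact: H.
    have -> : [set x | l < gn n x] = set0.
      by apply/seteqP; split => x //=; rewrite lt_min [l < n%:R]ltNge nl andbF.
    by rewrite measure0 !mule0 lee_fin.
  have lip x y : `|gn n y - gn n x| <= `|g y - g x| by exact: min_lipschitz.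
  move=> /le_trans /(_ (le_nonlocal_seminorm s lip)); rewrite Nr lee_fin.
  rewrite mulrC -ler_pdivlMr// => JrK.
  rewrite -(powRr1 (ltW J0)) -(@mulVf _ q) ?gt_eqF// powRrM.
  by rewrite powR_mono_le ?powR_ge0// divr_ge0// ltW.
have : (\int[mu]_x (g x `^ q)%:E <= ((r / K) `^ q)%:E)%E.
  have -> : (\int[mu]_x (g x `^ q)%:E = \int[mu]_x (limn (fun n => (gn n x `^ q)%:E)))%E.
    apply: eq_integral => x _; apply/esym/cvg_lim => //.
    apply: cvg_near_cst; near=> n; congr (_ `^ _)%:E.
    apply/min_idPl; near: n; exact: nbhs_infty_ger.
  rewrite monotone_convergence//.
  - apply: lime_le.
      apply: ereal_nondecreasing_is_cvgn => m n mn.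
      apply: ge0_le_integral_nomeas => x _; rewrite lee_fin ?powR_ge0//.
      apply: ge0_ler_powR; rewrite ?nnegrE ?gn0 ?(ltW q0)//.
      by rewrite /gn le_min !ge_min lexx/= ler_nat mn orbT.
    exact: nearW.
  - by move=> n x _; rewrite lee_fin powR_ge0.
  - move=> x _ m n mn; rewrite lee_fin; apply: ge0_ler_powR; rewrite ?nnegrE ?gn0 ?(ltW q0)//.
    by rewrite /gn le_min !ge_min lexx/= ler_nat mn orbT.
move=> h.
have -> : ('N[mu]_(q%:E)[EFin \o g] = (\int[mu]_x (g x `^ q)%:E) `^ q^-1)%E.
  rewrite unlock; apply: (congr1 (fun z => (z `^ q^-1)%E)).
  apply: eq_integral => x _.
  by rewrite /= ger0_norm.
rewrite muleC -lee_pdivlMr//.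
apply: (@le_trans _ _ (((r / K) `^ q)%:E `^ q^-1)%E).
  apply: gt0_ler_poweR => //; rewrite ?in_itv/= ?invr_ge0 ?(ltW q0) ?leey ?andbT//.
    by apply: integral_ge0 => x _; rewrite lee_fin powR_ge0.
  by rewrite lee_fin powR_ge0.
by rewrite poweR_EFin -powRrM divff ?gt_eqF// powRr1// divr_ge0// ltW.
Unshelve. all: by end_near. Qed.

End nonlocal_seminorm.

(** * Gaussian integrals *)

Section dot_product.
Context (R : realType).

Lemma dotvE n (u v : 'cV[R]_n) : dotv u v = (u^T *m v) 0 0.
Proof. by rewrite mxE; apply: eq_bigr => i _; rewrite mxE. Qed.

Lemma dotv_col_mx m n (u1 v1 : 'cV[R]_m) (u2 v2 : 'cV[R]_n) :
  dotv (col_mx u1 u2) (col_mx v1 v2) = dotv u1 v1 + dotv u2 v2.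
Proof. by rewrite !dotvE tr_col_mx mul_row_col mxE. Qed.

Lemma dotvC n (u v : 'cV[R]_n) : dotv u v = dotv v u.
Proof. by apply: eq_bigr => i _; rewrite mulrC. Qed.

Lemma dotvDl n (u v w : 'cV[R]_n) : dotv (u + v) w = dotv u w + dotv v w.
Proof. by rewrite !dotvE linearD/= mulmxDl mxE. Qed.

Lemma dotvZl n (c : R) (u w : 'cV[R]_n) : dotv (c *: u) w = c * dotv u w.
Proof. by rewrite !dotvE linearZ/= -scalemxAl mxE. Qed.

Lemma dotvBl n (u v w : 'cV[R]_n) : dotv (u - v) w = dotv u w - dotv v w.
Proof. by rewrite -scaleN1r dotvDl dotvZl mulN1r. Qed.

Lemma dotv_mulmx n (A : 'M[R]_n) (u v : 'cV[R]_n) :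
  dotv (A *m u) v = dotv u (A^T *m v).
Proof. by rewrite !dotvE trmx_mul mulmxA. Qed.

Lemma trmx_mul_cV n (u v : 'cV[R]_n) : u^T *m v = (dotv u v)%:M.
Proof. by rewrite [LHS]mx11_scalar dotvE. Qed.

Lemma dotv_scalar (x y : R) : dotv x%:M y%:M = x * y.
Proof. by rewrite dotvE tr_scalar_mx -scalar_mxM mxE mulr1n. Qed.

(** Completing the square in the first coordinate leaves the quadratic form of the Schur complement
    of [a]. *)
Lemma dotv_quad_block n (a : R) (b : 'cV[R]_n) (C : 'M[R]_n) (x : R) (u : 'cV[R]_n) :
  a != 0 ->
  dotv (block_mx a%:M b^T b C *m col_mx x%:M u) (col_mx x%:M u) =
  a * (x + dotv b u / a) ^+ 2 + dotv ((C - a^-1 *: (b *m b^T)) *m u) u.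
Proof.
move=> a0; rewrite mul_block_col dotv_col_mx trmx_mul_cV -scalar_mxM -raddfD/=.
rewrite dotv_scalar mul_mx_scalar dotvDl dotvZl.
rewrite mulmxBl dotvBl -scalemxAl dotvZl -mulmxA trmx_mul_cV mul_mx_scalar dotvZl.
by field.
Qed.

Lemma det_block_schur n (a : R) (b : 'cV[R]_n) (C : 'M[R]_n) : a != 0 ->
  \det (block_mx a%:M b^T b C) = a * \det (C - a^-1 *: (b *m b^T)).
Proof.
move=> a0.
have -> : block_mx a%:M b^T b C =
    block_mx 1%:M 0 (a^-1 *: b) 1%:M *m
    block_mx a%:M b^T 0 (C - a^-1 *: (b *m b^T)).
  rewrite mulmx_block !mul1mx !mul0mx ?mulmx0 !addr0 mul_mx_scalar scalerA.
  by rewrite divff// scale1r -scalemxAl addrC subrK.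
by rewrite det_mulmx det_lblock det_ublock !det1 !mul1r det_scalar1.
Qed.

End dot_product.

Section gauss.
Context (R : realType).
Local Notation M := (measurableTypeR R).

(** The integrand is a multiple of the normal density of mean [-m] and variance [1 / (2 a)]. *)
Lemma integral_gauss1 (a m : R) : 0 < a ->
  (\int[lebesgue_measure]_x (expR (- (a * (x + m) ^+ 2)))%:E = (Num.sqrt (pi / a))%:E)%E.
Proof.
move=> a0; pose sg := Num.sqrt ((2 * a)^-1).
have sg2 : sg ^+ 2 = (2 * a)^-1 by rewrite sqr_sqrtr// invr_ge0 mulr_ge0 ?ltW.
have sg0 : sg != 0 by rewrite gt_eqF// sqrtr_gt0 invr_gt0 mulr_gt0.
have pk : normal_peak sg = (Num.sqrt (pi / a))^-1.
  by rewrite /normal_peak sg2; congr (Num.sqrt _)^-1; field; rewrite gt_eqF.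
have pi0 : 0 < Num.sqrt (pi / a) :> R by rewrite sqrtr_gt0 divr_gt0// pi_gt0.
transitivity (\int[lebesgue_measure]_x ((Num.sqrt (pi / a))%:E * (normal_pdf (- m) sg x)%:E))%E.
  apply: eq_integral => x _; rewrite normal_pdfE// -EFinM; congr EFin.
  rewrite pk mulVKf ?gt_eqF// /normal_fun sg2 opprK; congr expR.
  by field; rewrite gt_eqF.
rewrite ge0_integralZl_EFin//; last 2 first.
- by move=> x _; rewrite lee_fin normal_pdf_ge0.
- by apply/measurable_EFinP; exact: measurable_normal_pdf.
by rewrite integral_normal_pdf mule1.
Qed.

(** Counterpart of [colv] on tuples with the Borel sigma-algebra, where the induction on the
    dimension takes place. *)
Definition tcol n (x : n.-tuple M) : 'cV[R]_n := \col_i (tnth x i : R).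

Lemma measurable_quad n (A : 'M[R]_n) (w : 'cV[R]_n) :
  measurable_fun [set: n.-tuple M]
    (fun x => dotv (A *m (tcol x - w)) (tcol x - w) : R).
Proof.
have mi i : measurable_fun [set: n.-tuple M] (fun x => (tcol x - w) i 0 : R).
  under eq_fun do rewrite !mxE.
  by apply: measurable_funB => //; exact: measurable_tnth.
rewrite /dotv; apply: measurable_sum => i; apply: measurable_funM => //.
under eq_fun do rewrite mxE.
by apply: measurable_sum => j; exact: measurable_funM.
Qed.

Lemma tcol_cons n (x : R) (t : n.-tuple M) :
  tcol (consT (x, t)) = col_mx x%:M (tcol t) :> 'cV[R]_(1 + n).
Proof.
apply/matrixP => i j; rewrite !mxE; case: splitP => k ik; rewrite !mxE.
  rewrite !ord1 mulr1n; congr (_ : R).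
  by rewrite (_ : i = ord0)//; apply/val_inj; rewrite /= ik ord1.
by rewrite (_ : i = lift ord0 k) ?tnthS//; apply/val_inj; rewrite /= ik.
Qed.

(** Induction on the dimension: after completing the square, the first coordinate is integrated out
    and leaves the Gaussian of the Schur complement, again symmetric and positive definite.
    Positivity of the determinant comes out of the same recursion. *)
Lemma gaussian_integral n (A : 'M[R]_n) : A^T = A -> pdmx A ->
  0 < \det A /\ forall w : 'cV[R]_n,
  (\int[borel_lebesgue R n]_x (expR (- dotv (A *m (tcol x - w)) (tcol x - w)))%:E =
   (Num.sqrt (pi ^+ n / \det A))%:E)%E.
Proof.
elim: n A => [|n IH] A symA pdA.
  rewrite det_mx00; split => // w; rewrite expr0 divr1 sqrtr1.
  rewrite /= integral_dirac//= ?diracT ?mul1e; last first.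
    apply/measurable_EFinP/measurableT_comp => //.
    by apply: measurable_funN; exact: measurable_quad.
  by rewrite /dotv big_ord0 oppr0 expR0.
pose a := A ord0 ord0.
pose A' : 'M[R]_(1 + n) := A.
pose b := dlsubmx A'; pose C := drsubmx A'.
have AE : A' = block_mx a%:M b^T b C.
  rewrite -[A']submxK; congr block_mx.
    by rewrite [LHS]mx11_scalar !mxE; congr (A _ _)%:M; apply/val_inj.
  by rewrite /b trmx_dlsub /A' symA.
pose S := C - a^-1 *: (b *m b^T).
have a0 : 0 < a.
  have := pdA (delta_mx ord0 0); rewrite /dotv (bigD1 ord0)//= big1 => [|i i0].
    rewrite !mxE eqxx mulr1 addr0 (bigD1 ord0)//= big1 => [|i i0].
      rewrite addr0 !mxE !eqxx mulr1; apply.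
      by apply/eqP => /matrixP /(_ ord0 0); rewrite !mxE !eqxx => /eqP; rewrite oner_eq0.
    by rewrite mxE (negbTE i0) mulr0.
  by rewrite mulrC mxE (negbTE i0) mul0r.
have symC : C^T = C by rewrite /C trmx_drsub /A' symA.
have symS : S^T = S.
  by rewrite /S linearB/= linearZ/= trmx_mul trmxK symC.
have pdS : pdmx S.
  move=> u u0.
  (* This first coordinate annihilates the completed square, so the form of [A] reduces to that of
     [S] at [u]. *)
  have := pdA (col_mx (- (dotv b u / a))%:M u).
  rewrite -[A]/A' AE dotv_quad_block ?gt_eqF// addNr expr0n mulr0 add0r; apply.
  apply: contraNneq u0; rewrite -[X in _ = X](@col_mx0 _ 1 n) => h.
  by have := congr1 (@dsubmx R 1 n 1) h; rewrite !col_mxKd => ->.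
have dA : \det A = a * \det S by rewrite -[A]/A' AE det_block_schur ?gt_eqF.
have [dS0 IHS] := IH S symS pdS.
split; first by rewrite dA mulr_gt0.
move=> w; pose w' : 'cV[R]_(1 + n) := w.
pose w0 := w ord0 0; pose w1 := dsubmx w'.
have wE : w' = col_mx w0%:M w1.
  rewrite -[w']vsubmxK; congr col_mx; rewrite [LHS]mx11_scalar !mxE.
  by congr (w _ _)%:M; apply/val_inj.
pose F (x : n.+1.-tuple M) := (expR (- dotv (A *m (tcol x - w)) (tcol x - w)))%:E.
have mF : measurable_fun setT F.
  by apply/measurable_EFinP/measurableT_comp => //; apply: measurable_funN; exact: measurable_quad.
have F0 x : (0 <= F x)%E by rewrite lee_fin expR_ge0.
rewrite -/(F _) /= /cons_measure ge0_integral_pushforward//; last exact: measurable_consT.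
rewrite preimage_setT fubini_tonelli2; last 2 first.
- exact: (measurableT_comp mF measurable_consT).
- by move=> z; exact: F0.
transitivity (\int[borel_lebesgue R n]_t ((Num.sqrt (pi / a))%:E *
    (expR (- dotv (S *m (tcol t - w1)) (tcol t - w1)))%:E))%E.
  apply: eq_integral => t _; rewrite /fubini_G.
  set e := expR _.
  pose m := dotv b (tcol t - w1) / a - w0.
  rewrite -(integral_gauss1 m a0) muleC -ge0_integralZl_EFin; last 4 first.
  - by [].
  - by move=> x _; rewrite lee_fin expR_ge0.
  - apply/measurable_EFinP/measurableT_comp => //; apply: measurable_funN.
    by apply: measurable_funM => //; apply: measurable_funX; exact: measurable_funD.
  - exact: expR_ge0.
  apply: eq_integral => x _; rewrite /F /= -EFinM -expRD; congr (expR _)%:E.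
  have -> : tcol (consT (x, t)) - w =
      col_mx (x - w0)%:M (tcol t - w1) :> 'cV[R]_(1 + n).
    transitivity (col_mx x%:M (tcol t) - col_mx w0%:M w1 : 'cV[R]_(1 + n)).
      by rewrite -tcol_cons -wE.
    by rewrite opp_col_mx add_col_mx -raddfB.
  rewrite -[A]/A' AE dotv_quad_block ?gt_eqF// /m /S addrA addrAC.
  ring.
rewrite ge0_integralZl_EFin; last 4 first.
- by [].
- by move=> x _; rewrite lee_fin expR_ge0.
- by apply/measurable_EFinP/measurableT_comp => //; apply: measurable_funN; exact: measurable_quad.
- by rewrite sqrtr_ge0.
rewrite IHS -EFinM -sqrtrM ?divr_ge0 ?pi_ge0 ?(ltW a0)//; congr (Num.sqrt _)%:E.
by rewrite dA exprS; field; rewrite !gt_eqF.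
Qed.
End gauss.

(** * The heat kernel *)

Section lebesgue_Rn_theory.
Context (R : realType) (N : nat).
Local Notation M := (measurableTypeR R).

Lemma borel_measurable_Rn (A : set (N.-tuple M)) :
  measurable A -> measurable (A : set (Rn R N)).
Proof.
by move=> mA; apply: (@sub_caratheodory _ _ _ (borel_lebesgue R N)); exact: sub_sigma_algebra.
Qed.

Lemma lebesgue_Rn_borel (A : set (N.-tuple M)) : measurable A ->
  lebesgue_Rn R N A = borel_lebesgue R N A.
Proof. by move=> mA; exact: measurable_mu_extE. Qed.

Lemma measurable_id_Rn :
  measurable_fun [set: Rn R N] (fun X : Rn R N => X : N.-tuple M).
Proof. by move=> _ B mB; rewrite setTI; exact: borel_measurable_Rn. Qed.

(** The identity map from the completed sigma-algebra to the Borel one is measurable and pushes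
    [lebesgue_Rn] forward to [borel_lebesgue]. *)
Lemma integral_lebesgue_Rn (F : N.-tuple M -> \bar R) :
  measurable_fun setT F -> (forall x, 0 <= F x)%E ->
  (\int[lebesgue_Rn R N]_X F X = \int[borel_lebesgue R N]_x F x)%E.
Proof.
move=> mF F0.
pose phi := fun X : Rn R N => X : N.-tuple M.
have := @ge0_integral_pushforward _ _ _ _ R phi measurable_id_Rn
  (lebesgue_Rn R N) setT F measurableT mF (fun x _ => F0 x).
rewrite preimage_setT => <-.
apply: eq_measure_integral => [|mphi A mA _]; first exact: measurable_id_Rn.
exact: lebesgue_Rn_borel.
Qed.

Lemma lebesgue_Rn_sigma_finite : sigma_finite setT (lebesgue_Rn R N).
Proof.
exact/completed_measure_extension_sigma_finite/sigma_finiteT.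
Qed.

HB.instance Definition _ := Measure_isSigmaFinite.Build _ _ _
  (@completed_measure_extension _ _ _ (borel_lebesgue R N)) lebesgue_Rn_sigma_finite.

(** The same measure as [lebesgue_Rn], packed as sigma-finite for the use of Tonelli's theorem. *)
Definition lebesgue_Rn_sf : {sigma_finite_measure set (Rn R N) -> \bar R} :=
  @completed_measure_extension _ _ _ (borel_lebesgue R N).

End lebesgue_Rn_theory.

(** * Bounds and normalization of the heat kernel *)

Section heat_kernel_theory.
Context (R : realType) (N : nat) (Q B : 'M[R]_N) (t : R).
Hypothesis t0 : 0 < t.
Hypothesis Ksym : (Kmx Q B t)^T = Kmx Q B t.
Hypothesis Kpd : pdmx (Kmx Q B t).
Hypothesis V0 : 0 < vol Q B t.
Local Notation K := (Kmx Q B t).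

Lemma pdmx_unit n (A : 'M[R]_n) : A^T = A -> pdmx A -> A \in unitmx.
Proof.
by move=> sA pA; rewrite unitmxE unitfE gt_eqF//; have [] := gaussian_integral sA pA.
Qed.

Lemma pdmx_inv n (A : 'M[R]_n) : A^T = A -> pdmx A -> pdmx (invmx A).
Proof.
move=> sA pA u u0; have uA := pdmx_unit sA pA.
have -> : u = A *m (invmx A *m u) by rewrite mulKVmx.
rewrite mulKmx// dotvC; apply: pA.
by apply: contraNneq u0 => h; rewrite -(mulKVmx uA u) h mulmx0.
Qed.

Lemma pdmxZ n (c : R) (A : 'M[R]_n) : 0 < c -> pdmx A -> pdmx (c *: A).
Proof. by move=> c0 pA u u0; rewrite -scalemxAl dotvZl mulr_gt0// pA. Qed.

Let A := (4 * t)^-1 *: invmx K.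

Let kernel_exponent X Y : kernel_dist Q B t X Y ^+ 2 / (4 * t) =
  dotv (A *m (tcol Y - expmx (t *: B) *m colv X)) (tcol Y - expmx (t *: B) *m colv X).
Proof.
rewrite /kernel_dist sqr_sqrtr /=; last first.
  set v : 'cV[R]_N := colv Y - _; have [->|v0] := eqVneq v 0.
    by rewrite mulmx0 /dotv big1// => i _; rewrite mxE mul0r.
  exact/ltW/(pdmx_inv Ksym Kpd).
by rewrite -scalemxAl dotvZl mulrC.
Qed.

Let pdA : pdmx A.
Proof. by apply: pdmxZ (pdmx_inv Ksym Kpd); rewrite invr_gt0 mulr_gt0. Qed.

Let symA : A^T = A.
Proof. by rewrite linearZ/= trmx_inv Ksym. Qed.

(** Read off from [V0]: the volume function is [omega R N] times a nonnegative root. *)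
Let omega_gt0 : 0 < omega R N.
Proof.
move: V0; rewrite /vol; have := sqrtr_ge0 (\det (t *: K)).
rewrite le_eqVlt => /predU1P[<-|d0]; first by rewrite mulr0 ltxx.
by rewrite pmulr_lgt0.
Qed.

Lemma heat_kernel_ge0 X Y : 0 <= heat_kernel Q B X Y t.
Proof.
by rewrite /heat_kernel mulr_ge0 ?expR_ge0// divr_ge0 ?(ltW V0)// mulr_ge0 ?powR_ge0// ltW.
Qed.

Lemma heat_kernel_le X Y :
  heat_kernel Q B X Y t <= omega R N * (4 * pi) `^ (- (N%:R / 2)) / vol Q B t.
Proof.
rewrite /heat_kernel; apply: ler_piMr.
  by rewrite divr_ge0 ?(ltW V0)// mulr_ge0 ?powR_ge0// ltW.
by rewrite -expR0 ler_expR oppr_le0 divr_ge0 ?sqr_ge0// mulr_ge0// ltW.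
Qed.

Let measurable_exponent X : measurable_fun [set: N.-tuple (measurableTypeR R)]
  (fun Y : N.-tuple (measurableTypeR R) => expR (- (kernel_dist Q B t X Y ^+ 2 / (4 * t)))).
Proof.
under eq_fun do rewrite kernel_exponent.
by apply: measurableT_comp => //; apply: measurable_funN; exact: measurable_quad.
Qed.

Lemma measurable_heat_kernel X :
  measurable_fun [set: Rn R N] (fun Y => heat_kernel Q B X Y t).
Proof.
apply: measurable_funM; first exact: measurable_cst.
exact: (measurableT_comp (measurable_exponent X) (@measurable_id_Rn R N)).
Qed.

(** The Gaussian integral for [(4 t)^-1 K^-1] is the square root of [(4 pi)^N det (t K)], which
    cancels [(4 pi)^(-N/2)] and the root in [V(t)]; the factors [omega] cancel each other. *)
Lemma integral_heat_kernel X :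
  (\int[lebesgue_Rn R N]_Y (heat_kernel Q B X Y t)%:E = 1)%E.
Proof.
set c := omega R N * (4 * pi) `^ (- (N%:R / 2)) / vol Q B t.
have c0 : 0 <= c by rewrite divr_ge0 ?(ltW V0)// mulr_ge0 ?powR_ge0// ltW.
under eq_integral do rewrite /heat_kernel -/c EFinM.
rewrite ge0_integralZl_EFin; last 4 first.
- exact: measurableT.
- by move=> Y _; rewrite lee_fin expR_ge0.
- apply/measurable_EFinP.
  exact: (measurableT_comp (measurable_exponent X) (@measurable_id_Rn R N)).
- exact: c0.
rewrite (@integral_lebesgue_Rn R N
  (fun Y => (expR (- (kernel_dist Q B t X Y ^+ 2 / (4 * t))))%:E)); last 2 first.
- exact/measurable_EFinP.
- by move=> x; rewrite lee_fin expR_ge0.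
under eq_integral do rewrite kernel_exponent.
have [dA ->] := gaussian_integral symA pdA.
have [dK _] := gaussian_integral Ksym Kpd.
rewrite -EFinM; congr EFin.
have -> : pi ^+ N / \det A = (4 * pi) ^+ N * \det (t *: K).
  rewrite /A (detZ _ (invmx K)) (detZ _ K) det_inv exprVn !exprMn.
  have : 0 < (4 : R) ^+ N by rewrite exprn_gt0.
  have : 0 < t ^+ N by rewrite exprn_gt0.
  move: (4 ^+ N) (t ^+ N) (pi ^+ N) => x y z y0 x0. field.
  by rewrite !gt_eqF.
rewrite sqrtrM ?exprn_ge0 ?mulr_ge0 ?pi_ge0// /c /vol.
have : (4 * pi) `^ (- (N%:R / 2)) * Num.sqrt ((4 * pi) ^+ N) = 1 :> R.
  have p0 : 0 < 4 * pi :> R by rewrite mulr_gt0 ?pi_gt0.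
  rewrite -powR12_sqrt ?exprn_ge0 ?(ltW p0)// -powR_mulrn ?(ltW p0)// -powRrM.
  by rewrite -powRD ?addNr ?powRr0//; apply/implyP => _; rewrite gt_eqF.
set x := _ `^ _; set y := Num.sqrt _ => xy.
have d0 : 0 < Num.sqrt (\det (t *: K)) by rewrite sqrtr_gt0 (detZ _ K) mulr_gt0 ?exprn_gt0.
rewrite -[RHS]xy; field; rewrite !gt_eqF//.
Qed.

End heat_kernel_theory.

(** * The matrix exponential *)

Lemma cvg_sum_fin (R : realType) (T : Type) (F : set_system T) (I : finType)
    (f : I -> T -> R) (l : I -> R) : Filter F ->
  (forall i, f i x @[x --> F] --> l i) ->
  (\sum_i f i x) @[x --> F] --> \sum_i l i.
Proof.
move=> FF h; have -> : (fun x => \sum_i f i x) = \sum_i f i.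
  by apply/funext => n; rewrite fct_sumE.
elim/big_ind2 : _ => [|g a k b ga kb|i _]; [exact: cvg_cst|exact: cvgD|exact: h].
Qed.

Section matrix_exponential.
Context (R : realType) (N : nat).
Implicit Types B P : 'M[R]_N.

Definition mx_sum_norm P : R := \sum_i \sum_j `|P i j|.

Lemma le_mx_sum_norm P i : \sum_j `|P i j| <= mx_sum_norm P.
Proof.
rewrite /mx_sum_norm [leRHS](bigD1 i)//= lerDl; apply: sumr_ge0 => k _.
exact: sumr_ge0.
Qed.

Lemma mx_sum_norm_ge0 P : 0 <= mx_sum_norm P.
Proof. by apply: sumr_ge0 => i _; exact: sumr_ge0. Qed.

Lemma norm_mxX_entry B k i j : `|(B ^+ k) i j| <= mx_sum_norm B ^+ k.
Proof.
elim: k i j => [|k IH] i j.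
  by rewrite !expr0 mxE; case: (i == j); rewrite ?normr1 ?normr0.
rewrite exprS mxE; apply: le_trans (ler_norm_sum _ _ _) _.
apply: (@le_trans _ _ (\sum_l `|B i l| * mx_sum_norm B ^+ k)).
  by apply: ler_sum => l _; rewrite normrM; apply: ler_wpM2l.
rewrite -mulr_suml exprS; apply: ler_wpM2r; last exact: le_mx_sum_norm.
by rewrite exprn_ge0// mx_sum_norm_ge0.
Qed.

(** Coefficients of the power series in [x] of an entry of [P e^(xB)]. The left factor [P] closes
    the family under differentiation, which replaces [P] by [P B]. *)
Definition expmx_coef P B i j (k : nat) : R := (k`!%:R)^-1 * (P *m B ^+ k) i j.

(** Comparison with a multiple of the exponential series at [b |x|], where [b] bounds [B]
    submultiplicatively. *)
Lemma is_cvg_expmx_coef P B i j x : cvgn (pseries (expmx_coef P B i j) x).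
Proof.
apply: normed_cvg.
pose b := mx_sum_norm B; pose r := mx_sum_norm P.
apply: (@series_le_cvg _ _ (fun k => r * exp_coeff (b * `|x|) k)).
- by move=> k; exact: normr_ge0.
- by move=> k; rewrite mulr_ge0 ?mx_sum_norm_ge0// exp_coeff_ge0// mulr_ge0// mx_sum_norm_ge0.
- move=> k /=; rewrite /expmx_coef normrM normrM normfV normrX exp_coeffE /= exprMn.
  rewrite ger0_norm//.
  have -> : r * (k`!%:R^-1 * (b ^+ k * `|x| ^+ k)) =
      k`!%:R^-1 * (r * b ^+ k) * `|x| ^+ k by ring.
  apply: ler_wpM2r; first by rewrite exprn_ge0.
  apply: ler_wpM2l; first by rewrite invr_ge0.
  rewrite mxE; apply: le_trans (ler_norm_sum _ _ _) _.
  apply: (@le_trans _ _ (\sum_l `|P i l| * b ^+ k)).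
    by apply: ler_sum => l _; rewrite normrM; apply: ler_wpM2l => //; exact: norm_mxX_entry.
  rewrite -mulr_suml; apply: ler_wpM2r; last exact: le_mx_sum_norm.
  by rewrite exprn_ge0// mx_sum_norm_ge0.
- by apply: is_cvg_seriesZ; exact: is_cvg_series_exp_coeff.
Qed.

Lemma pseries_diffs_expmx_coef P B i j :
  pseries_diffs (expmx_coef P B i j) = expmx_coef (P *m B) B i j.
Proof.
apply/funext => k; rewrite /pseries_diffs /expmx_coef exprS mulmxA mulrA.
by rewrite factS natrM invfM mulVKf.
Qed.

Lemma cvg_matrix (u : nat -> 'M[R]_N) (L : 'M[R]_N) :
  (forall i j, u k i j @[k --> \oo] --> L i j) -> u @ \oo --> L.
Proof.
move=> h; apply/cvg_ballP => e e0.
have : \forall k \near \oo, forall i, forall j, ball (L i j) e (u k i j).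
  apply: filter_forall => i; apply: filter_forall => j.
  by have /cvg_ballP := h i j; exact.
by apply: filterS => k hk; split.
Qed.

Lemma exprZ_mx B (t : R) k : (t *: B) ^+ k = t ^+ k *: B ^+ k.
Proof.
elim: k => [|k IH]; first by rewrite !expr0 scale1r.
by rewrite !exprS IH -[LHS]/(_ *m _) -scalemxAl -scalemxAr scalerA.
Qed.

(** Passes from the limit of matrices to scalar power series, which can be differentiated term by
    term. *)
Lemma expmxE B (t : R) i j :
  expmx (t *: B) i j = limn (pseries (expmx_coef 1%:M B i j) t).
Proof.
pose L : 'M[R]_N := \matrix_(i, j) limn (pseries (expmx_coef 1%:M B i j) t).
suff : series (fun k : nat => (k`!%:R)^-1 *: (t *: B) ^+ k) @ \oo --> L.
  by move=> /cvg_lim -/(_ (@norm_hausdorff _ _)); rewrite /expmx => ->; rewrite mxE.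
apply: cvg_matrix => {}i {}j.
have -> : (fun k => series (fun k : nat => (k`!%:R)^-1 *: (t *: B) ^+ k) k i j) =
    pseries (expmx_coef 1%:M B i j) t.
  apply/funext => n; rewrite /pseries /series/= summxE; apply: eq_bigr => k _.
  by rewrite /expmx_coef mul1mx exprZ_mx !mxE mulrAC mulrA.
by rewrite mxE; exact: is_cvg_expmx_coef.
Qed.

Lemma lim_expmx_coef P B (t : R) i j :
  limn (pseries (expmx_coef P B i j) t) = (P *m expmx (t *: B)) i j.
Proof.
apply/cvg_lim => //; rewrite mxE.
have -> : pseries (expmx_coef P B i j) t =
    (fun n => \sum_l P i l * pseries (expmx_coef 1%:M B l j) t n).
  apply/funext => n; rewrite /pseries /series/=.
  under [RHS]eq_bigr do rewrite mulr_sumr.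
  rewrite exchange_big/=; apply: eq_bigr => k _.
  rewrite /expmx_coef mxE mulr_sumr mulr_suml; apply: eq_bigr => l _.
  by rewrite mul1mx; ring.
apply: cvg_sum_fin => l; rewrite expmxE; apply: cvgMl_tmp.
exact: is_cvg_expmx_coef.
Qed.

Lemma is_derive_expmx B (t : R) i j :
  is_derive t (1 : R) (fun t => expmx (t *: B) i j) ((B *m expmx (t *: B)) i j).
Proof.
rewrite -lim_expmx_coef; under eq_fun do rewrite expmxE.
have := @pseries_snd_diffs R (expmx_coef 1%:M B i j) (`|t| + 1) t.
rewrite !pseries_diffs_expmx_coef mul1mx; apply.
- exact: is_cvg_expmx_coef.
- exact: is_cvg_expmx_coef.
- exact: is_cvg_expmx_coef.
- by rewrite [ltRHS]ger0_norm ?ltrDl ?addr_ge0.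
Qed.

Lemma expmx_comm B (t : R) : B *m expmx (t *: B) = expmx (t *: B) *m B.
Proof.
apply/matrixP => i j; rewrite -lim_expmx_coef.
have -> : expmx_coef B B i j = (fun k => \sum_l expmx_coef 1%:M B i l k * B l j).
  apply/funext => k; rewrite /expmx_coef mul1mx.
  rewrite -[B *m _]/(B * B ^+ k) -exprS exprSr mxE mulr_sumr.
  by apply: eq_bigr => l _; rewrite mulrA.
apply/cvg_lim => //; rewrite mxE.
have -> : pseries (fun k => \sum_l expmx_coef 1%:M B i l k * B l j) t =
    (fun n => \sum_l pseries (expmx_coef 1%:M B i l) t n * B l j).
  apply/funext => n; rewrite /pseries /series/=.
  under [RHS]eq_bigr do rewrite mulr_suml.
  rewrite exchange_big/=; apply: eq_bigr => k _.
  by rewrite mulr_suml; apply: eq_bigr => l _; ring.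
apply: cvg_sum_fin => l; rewrite expmxE; apply: cvgMr_tmp.
exact: is_cvg_expmx_coef.
Qed.

Lemma expmx0 B : expmx (0 *: B) = 1%:M.
Proof.
apply/matrixP => i j; rewrite expmxE; apply/cvg_lim => //.
apply: cvg_near_cst; near=> n.
have n0 : (0 < n)%N by near: n; exact: nbhs_infty_gt.
rewrite /pseries /series/= -(prednK n0) big_nat_recl//= big1 ?addr0.
  by rewrite /expmx_coef fact0 invr1 !mul1r expr0 mulr1 mul1mx.
by move=> k _; rewrite exprS mul0r mulr0.
Unshelve. all: by end_near. Qed.

Lemma trmx_expmx B (t : R) : (expmx (t *: B))^T = expmx (t *: B^T).
Proof.
apply/matrixP => i j; rewrite mxE !expmxE; congr (limn (pseries _ t)).
apply/funext => k; rewrite /expmx_coef !mul1mx; congr (_ * _).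
elim: k i j => [|k IH] i j; first by rewrite !expr0 !mxE eq_sym.
rewrite exprSr exprS !mxE; apply: eq_bigr => l _.
by rewrite IH mxE mulrC.
Qed.

(** The product [e^(tB) e^((u+v-t)B)] has zero derivative in [t], as [B] commutes with [e^(tB)]; its
    values at [t = u] and [t = 0] are compared. *)
Lemma expmxD B (u v : R) : expmx ((u + v) *: B) = expmx (u *: B) *m expmx (v *: B).
Proof.
apply/matrixP => i j.
pose Phi t := (expmx (t *: B) *m expmx ((u + v - t) *: B)) i j.
have dPhi t : is_derive t (1 : R) Phi 0.
  have -> : Phi = \sum_l ((fun t => expmx (t *: B) i l) *
      ((fun t => expmx (t *: B) l j) \o (fun t => u + v - t))).
    by apply/funext => x; rewrite /Phi mxE fct_sumE; apply: eq_bigr.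
  have dl l : is_derive t (1 : R) ((fun t => expmx (t *: B) l j) \o (fun t => u + v - t))
      (- (B *m expmx ((u + v - t) *: B)) l j).
    have d1 : is_derive t (1 : R) (fun t : R => u + v - t) (-1).
      have -> : (fun t : R => u + v - t) = cst (u + v) - id by [].
      by apply: is_derive_eq; rewrite sub0r.
    have := @is_derive1_comp R (fun t => expmx (t *: B) l j) (fun t => u + v - t) t _ _
      (is_derive_expmx B (u + v - t) l j) d1.
    by rewrite mulrN1.
  have := @is_derive_sum R R R N _ t 1 _ (fun l =>
    @is_deriveM R R _ _ t 1 _ _ (is_derive_expmx B t i l) (dl l)).
  move=> h; apply: is_derive_eq.
  rewrite big_split/= /GRing.scale/=.
  have -> : \sum_l expmx (t *: B) i l * - (B *m expmx ((u + v - t) *: B)) l j =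
      - (expmx (t *: B) *m (B *m expmx ((u + v - t) *: B))) i j.
    by rewrite mxE -sumrN; apply: eq_bigr => l _; rewrite mulrN.
  have -> : \sum_l expmx ((u + v - t) *: B) l j * (B *m expmx (t *: B)) i l =
      (B *m expmx (t *: B) *m expmx ((u + v - t) *: B)) i j.
    by rewrite [RHS]mxE; apply: eq_bigr => l _; rewrite mulrC.
  by rewrite (expmx_comm B t) -mulmxA addNr.
have := is_derive_0_is_cst u 0 dPhi; rewrite /Phi subr0 expmx0 mul1mx => <-.
by rewrite addrAC subrr add0r.
Qed.

End matrix_exponential.

(** * Determinants near the identity and of the exponential *)

Section det_exp.
Context (R : realType).

Lemma prod_near1 (I : Type) (r : seq I) (e : I -> R) (eps : R) :
  0 <= eps <= 1 -> (forall i, `|e i| <= eps) ->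
  `|\prod_(i <- r) (1 + e i) - 1 - \sum_(i <- r) e i| <= 4 ^+ size r * eps ^+ 2.
Proof.
move=> /andP[e0 e1] he.
(* The bound on the sum is carried along in the induction to control the cross term [e i * S]. *)
suff : `|\sum_(i <- r) e i| <= 4 ^+ size r * eps /\
  `|\prod_(i <- r) (1 + e i) - 1 - \sum_(i <- r) e i| <= 4 ^+ size r * eps ^+ 2 by case.
elim: r => [|i r [IHs IHp]].
  by rewrite !big_nil !subr0 subrr !normr0 expr0 !mul1r; split; rewrite ?exprn_ge0.
rewrite !big_cons/=; move: IHs IHp; set S := \sum_(_ <- _) _; set P := \prod_(_ <- _) _.
have n1 : 1 <= 4 ^+ size r :> R by rewrite exprn_ege1// ler1n.
rewrite (exprS 4); move: (4 ^+ size r) n1 => c c1 IHs IHp.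
split.
  apply: le_trans (ler_normD _ _) _.
  have : eps <= c * eps by rewrite ler_peMl.
  by have := he i; lra.
have -> : (1 + e i) * P - 1 - (e i + S) = (P - 1 - S) + e i * (P - 1 - S) + e i * S by ring.
apply: le_trans (ler_normD _ _) _; rewrite normrM.
have h1 : `|P - 1 - S + e i * (P - 1 - S)| <= c * eps ^+ 2 + 1 * (c * eps ^+ 2).
  apply: le_trans (ler_normD _ _) _; rewrite normrM; apply: lerD => //.
  by apply: ler_pM => //; exact: le_trans (he i) e1.
have h2 : `|e i| * `|S| <= eps * (c * eps) by apply: ler_pM.
apply: le_trans (lerD h1 h2) _; have : 0 <= c * eps ^+ 2 by rewrite mulr_ge0 ?exprn_ge0//; lra.
have -> : eps * (c * eps) = c * eps ^+ 2 by ring.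
by rewrite -mulrA; lra.
Qed.

(** A nonidentity permutation moves two indices, some [i] and [s i], which gives two off-diagonal
    factors of size at most [eps]; the other factors are at most 2. *)
Lemma perm_prod_small n (E : 'M[R]_n) (s : 'S_n) (eps : R) :
  0 <= eps <= 1 -> (forall i j, `|E i j| <= eps) -> s != 1%g ->
  `|\prod_i (1%:M + E) i (s i)| <= 2 ^+ n * eps ^+ 2.
Proof.
move=> /andP[e0 e1] hE s1.
have [i si] : exists i, s i != i.
  apply/existsP; apply: contraNT s1; rewrite negb_exists => /forallP h.
  by apply/eqP/permP => i; rewrite perm1; apply/eqP; move: (h i); rewrite negbK.
have sj : s (s i) != s i by apply: contraNneq si => /perm_inj ->.
have off k : s k != k -> `|(1%:M + E) k (s k)| <= eps.
  by move=> sk; rewrite !mxE eq_sym (negbTE sk) add0r.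
have bnd k : `|(1%:M + E) k (s k)| <= 2.
  rewrite !mxE; apply: le_trans (ler_normD _ _) _.
  have := hE k (s k); case: (k == s k); rewrite ?normr1 ?normr0; lra.
rewrite normr_prod (bigD1 i)//= (bigD1 (s i))//= mulrA mulrC.
apply: ler_pM; rewrite ?mulr_ge0 ?prodr_ge0//.
  apply: (@le_trans _ _ (\prod_(k < n | (k != i) && (k != s i)) 2)).
    by apply: ler_prod => k _; rewrite normr_ge0 bnd.
  rewrite prodr_const; apply: ler_weXn2l; first by rewrite ler1n.
  by rewrite -[leqRHS]card_ord; exact: max_card.
by rewrite expr2; apply: ler_pM => //; exact: off.
Qed.

(** In the Leibniz expansion the identity permutation contributes [1 + tr E] up to second order, and
    every other permutation is of second order. *)
Lemma det_near1 n : exists2 C : R, 0 <= C & forall (E : 'M[R]_n) (eps : R),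
  0 <= eps <= 1 -> (forall i j, `|E i j| <= eps) ->
  1 + \tr E - C * eps ^+ 2 <= \det (1%:M + E).
Proof.
exists (4 ^+ n + #|'S_n|%:R * 2 ^+ n); first by rewrite addr_ge0 ?mulr_ge0 ?exprn_ge0.
move=> E eps e01 hE.
rewrite /(\det _) (bigD1 1%g)//= odd_perm1 expr0 mul1r.
have h1 : 1 + \tr E - 4 ^+ n * eps ^+ 2 <= \prod_i (1%:M + E) i ((1%g : 'S_n) i).
  have -> : \prod_i (1%:M + E) i ((1%g : 'S_n) i) = \prod_i (1 + E i i).
    by apply: eq_bigr => i _; rewrite perm1 !mxE eqxx.
  have := @prod_near1 'I_n (index_enum 'I_n) (fun i => E i i) eps e01 (fun i => hE i i).
  have -> : size (index_enum 'I_n) = n by rewrite -[index_enum _]enumT size_enum_ord.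
  rewrite ler_norml => /andP[+ _]; rewrite /mxtrace; lra.
have h2 : - (#|'S_n|%:R * 2 ^+ n * eps ^+ 2) <=
    \sum_(s : 'S_n | s != 1%g) (-1) ^+ s * \prod_i (1%:M + E) i (s i).
  apply: (@le_trans _ _ (\sum_(s : 'S_n | s != 1%g) - (2 ^+ n * eps ^+ 2))).
    rewrite sumr_const -[leRHS]mulr_natl -mulrA mulrN lerN2.
    apply: ler_wpM2r; first by rewrite mulr_ge0 ?exprn_ge0//; case/andP: e01.
    by rewrite ler_nat max_card.
  apply: ler_sum => s s1; have := perm_prod_small e01 hE s1.
  by rewrite -(normrMsign s) ler_norml => /andP[].
apply: le_trans (lerD h1 h2); rewrite mulrDl; lra.
Qed.

Lemma bernoulli_ineq (x : R) m : 0 <= x <= 1 -> 1 - m%:R * x <= (1 - x) ^+ m.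
Proof.
move=> /andP[x0 x1]; elim: m => [|m IH]; first by rewrite mul0r subr0 expr0.
rewrite exprS; apply: (@le_trans _ _ ((1 - x) * (1 - m%:R * x))).
  have : 0 <= m%:R * x ^+ 2 by rewrite mulr_ge0// exprn_ge0.
  by rewrite -[m.+1%:R]natr1; lra.
by apply: ler_wpM2l => //; rewrite subr_ge0.
Qed.

(** For small [h > 0] the determinant of [e^(hB)] is at least [1 + h tr B - o(h)], hence at least
    [1 - e h]. The determinant of [e^(uB)] is the [m]-th power of that of [e^((u/m)B)], and
    Bernoulli's inequality concludes for large [m]. *)
Lemma det_expmx_ge1 n (B : 'M[R]_n) (u : R) : 0 <= \tr B -> 0 <= u ->
  1 <= \det (expmx (u *: B)).
Proof.
move=> trB; rewrite le_eqVlt => /predU1P[<-|u0]; first by rewrite expmx0 det1.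
have [C C0 hC] := det_near1 n.
have key (e : R) : 0 < e -> \forall h \near 0^'+, 1 - e * h <= \det (expmx (h *: B)).
  move=> e0.
  (* The summand 1 absorbs the derivative error, so that [h b] bounds every entry of
     [e^(hB) - 1]. *)
  pose b := 1 + \sum_i \sum_j `|B i j|.
  have b1 : 1 <= b by rewrite lerDl; apply: sumr_ge0 => i _; exact: sumr_ge0.
  have Bb i j : `|B i j| + 1 <= b.
    rewrite /b [leRHS]addrC lerD2r (bigD1 i)//= (bigD1 j)//= -addrA lerDl addr_ge0//.
      exact: sumr_ge0.
    by apply: sumr_ge0 => k _; exact: sumr_ge0.
  (* The bound by 1 serves the entry estimate; the other makes the [n] diagonal errors cost at most
     [e h / 2], leaving [e h / 2] for the quadratic term. *)
  pose k := Num.min 1 (e / (2 * n.+1%:R)).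
  have k0 : 0 < k by rewrite lt_min ltr01/= divr_gt0.
  have deriv : \forall h \near 0^'+, forall i j,
      `|expmx (h *: B) i j - (1%:M : 'M[R]_n) i j - h * B i j| <= k * h.
    apply: filter_forall => i; apply: filter_forall => j.
    have [/cvg_ex[l hl]] := is_derive_expmx B 0 i j.
    rewrite /derive (cvg_lim _ hl)//= expmx0 mulmx1 => lB; rewrite lB in hl.
    have /cvgrPdist_le/(_ _ k0) := cvg_dnbhs_at_right hl.
    apply: filter_app; near=> h => /=.
    have h0 : 0 < h by near: h; exact: nbhs_right_gt.
    rewrite addr0 /GRing.scale/= mulr1 expmx0 distrC => hk.
    have -> : expmx (h *: B) i j - (1%:M : 'M[R]_n) i j - h * B i j =
      h * (h^-1 * (expmx (h *: B) i j - (1%:M : 'M[R]_n) i j) - B i j).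
      by field; rewrite gt_eqF.
    by rewrite normrM gtr0_norm// mulrC ler_pM2r.
  have small : \forall h \near 0^'+, h * (C * b ^+ 2) <= e / 2 /\ h * b <= 1.
    have b0 : 0 < b by lra.
    have c0 : 0 <= C * b ^+ 2 by rewrite mulr_ge0// exprn_ge0// ltW.
    have c10 : 0 < C * b ^+ 2 + 1 by lra.
    near=> h.
    have h0 : 0 < h by near: h; exact: nbhs_right_gt.
    have h1 : h <= e / 2 / (C * b ^+ 2 + 1).
      by near: h; apply: nbhs_right_le; rewrite !divr_gt0.
    have h2 : h <= b^-1 by near: h; apply: nbhs_right_le; rewrite invr_gt0.
    split; last by rewrite -ler_pdivlMr// div1r.
    by move: h1; rewrite ler_pdivlMr// mulrDr mulr1; lra.
  near=> h.
  have h0 : 0 < h by near: h; exact: nbhs_right_gt.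
  have dh i j : `|expmx (h *: B) i j - (1%:M : 'M[R]_n) i j - h * B i j| <= k * h.
    by move: i j; near: h.
  have [hb1 hb2] : h * (C * b ^+ 2) <= e / 2 /\ h * b <= 1 by near: h.
  pose E := expmx (h *: B) - 1%:M.
  have -> : expmx (h *: B) = 1%:M + E by rewrite addrC subrK.
  have hE i j : `|E i j| <= h * b.
    have -> : E i j = (expmx (h *: B) i j - (1%:M : 'M[R]_n) i j - h * B i j) + h * B i j.
      by rewrite !mxE; ring.
    apply: le_trans (ler_normD _ _) _; rewrite [in X in _ + X]normrM (gtr0_norm h0).
    apply: le_trans (lerD (dh i j) (lexx _)) _.
    rewrite (mulrC k) -mulrDr; apply: ler_wpM2l; first exact: ltW.
    apply: le_trans (Bb i j); rewrite addrC lerD2l; by rewrite ge_min lexx.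
  have e01 : 0 <= h * b <= 1 by rewrite hb2 mulr_ge0 ?(ltW h0)//; lra.
  apply: le_trans (hC E (h * b) e01 hE).
  have trE : - (n%:R * (k * h)) <= \tr E.
    apply: (@le_trans _ _ (\tr E - h * \tr B)); last first.
      by rewrite lerBlDr lerDl mulr_ge0// ltW.
    rewrite /mxtrace mulr_sumr -sumrB.
    apply: (@le_trans _ _ (\sum_(i < n) - (k * h))).
      by rewrite sumr_const card_ord -[leRHS]mulr_natl mulrN.
    apply: ler_sum => i _; have := dh i i; rewrite ler_norml => /andP[+ _].
    by rewrite !mxE; lra.
  have kn : n%:R * k <= e / 2.
    apply: (@le_trans _ _ (n%:R * (e / (2 * n.+1%:R)))).
      by apply: ler_wpM2l => //; rewrite ge_min lexx orbT.
    rewrite mulrA ler_pdivrMr ?mulr_gt0//.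
    have -> : e / 2 * (2 * n.+1%:R) = e * n.+1%:R by field.
    by rewrite mulrC ler_pM2l// ler_nat.
  have : C * (h * b) ^+ 2 = h * (h * (C * b ^+ 2)) by ring.
  have : h * (h * (C * b ^+ 2)) <= h * (e / 2) by apply: ler_wpM2l => //; exact: ltW.
  have : n%:R * k * h <= e / 2 * h by apply: ler_wpM2r => //; exact: ltW.
  lra.
have detX h m : \det (expmx ((m%:R * h) *: B)) = \det (expmx (h *: B)) ^+ m.
  elim: m => [|m IH]; first by rewrite mul0r expmx0 det1 expr0.
  by rewrite -addn1 natrD mulrDl mul1r expmxD det_mulmx IH exprD expr1.
suff main (e : R) : 0 < e -> 1 - e <= \det (expmx (u *: B)).
  by apply/ler_addgt0Pr => e e0; rewrite -lerBlDr; exact: main.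
(* Losses at this rate add up to at most [e] over [[0, u]]; the minimum with 1 keeps Bernoulli's
   inequality applicable. *)
move=> e0; have e'0 : 0 < Num.min e 1 / u by rewrite divr_gt0// lt_min e0/=.
have [d /= d0 hd] := key _ e'0.
pose m := (Num.truncn (u / d)).+1.
have m0 : 0 < m%:R :> R by rewrite ltr0n.
have um : u / m%:R < d.
  rewrite ltr_pdivrMr// mulrC -ltr_pdivrMr//.
  by rewrite /m truncnS_gt.
have := hd (u / m%:R).
rewrite /= sub0r normrN gtr0_norm ?divr_gt0// => /(_ um isT) hm.
have -> : u = m%:R * (u / m%:R) by field; rewrite gt_eqF.
have x1 : Num.min e 1 / u * (u / m%:R) <= 1.
  have -> : Num.min e 1 / u * (u / m%:R) = Num.min e 1 / m%:R by field; rewrite !gt_eqF.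
  rewrite ler_pdivrMr// mul1r ge_min; apply/orP; right.
  by rewrite ler1n.
rewrite detX; apply: le_trans (lerXn2r _ _ _ hm); last 2 first.
- by rewrite nnegrE subr_ge0.
- by rewrite nnegrE; apply: le_trans hm; rewrite subr_ge0.
apply: le_trans (bernoulli_ineq _ _); last first.
  by rewrite x1 mulr_ge0 ?divr_ge0 ?(ltW u0) ?(ltW m0)// le_min ltW//= ler01.
have -> : m%:R * (Num.min e 1 / u * (u / m%:R)) = Num.min e 1 by field; rewrite !gt_eqF.
by rewrite lerD2l lerN2 ge_min lexx.
Unshelve. all: by end_near. Qed.

End det_exp.

(** * The covariance matrix *)

Section covariance.
Context (R : realType) (N : nat).
Local Notation lam := (@lebesgue_measure R).

Lemma cont_integrable (h : R -> R) (a b : R) : continuous h ->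
  lam.-integrable `[a, b] (EFin \o h).
Proof.
move=> ch; apply: continuous_compact_integrable; first exact: segment_compact.
exact: continuous_subspaceT.
Qed.

Lemma Rintegral_sum_cont (I : finType) (c : I -> R) (h : I -> R -> R) (a b : R) :
  (forall i, continuous (h i)) ->
  \int[lam]_(x in `[a, b]) (\sum_i c i * h i x) = \sum_i c i * \int[lam]_(x in `[a, b]) h i x.
Proof.
move=> ch; elim: (index_enum I) => [|i r IH].
  by rewrite big_nil; under eq_Rintegral do rewrite big_nil; rewrite Rintegral_cst ?mul0r.
rewrite big_cons -IH; under eq_Rintegral do rewrite big_cons.
have cs : continuous (fun x => \sum_(j <- r) c j * h j x).
  have -> : (fun x => \sum_(j <- r) c j * h j x) = \sum_(j <- r) (fun x => c j * h j x).
    by apply/funext => x; rewrite fct_sumE.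
  elim/big_ind : _ => [|f g cf cg x|j _ x]; first exact: cst_continuous.
    by apply: cvgD; [exact: cf|exact: cg].
  by apply: cvgMl_tmp; exact: ch.
have ci : continuous (fun x => c i * h i x).
  by move=> x; apply: cvgMl_tmp; exact: ch.
rewrite RintegralD//; [|exact: cont_integrable..].
by rewrite RintegralZl//; exact: cont_integrable.
Qed.

Lemma continuous_mulmx (H1 H2 : R -> 'M[R]_N) :
  (forall i j, continuous (fun r => H1 r i j)) ->
  (forall i j, continuous (fun r => H2 r i j)) ->
  forall i j, continuous (fun r => (H1 r *m H2 r) i j).
Proof.
move=> c1 c2 i j x; under eq_fun do rewrite mxE.
apply: cvg_sum_fin => k.
by apply: cvgM; [exact: c1|exact: c2].
Qed.

Definition intmx (H : R -> 'M[R]_N) (t : R) : 'M[R]_N :=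
  \matrix_(i, j) \int[lam]_(r in `[0, t]) (H r i j).

Lemma intmx_mull (P : 'M[R]_N) (H : R -> 'M[R]_N) t :
  (forall i j, continuous (fun r => H r i j)) ->
  intmx (fun r => P *m H r) t = P *m intmx H t.
Proof.
move=> cH; apply/matrixP => i j; rewrite !mxE.
under eq_Rintegral do rewrite mxE.
rewrite (@Rintegral_sum_cont _ (fun k => P i k) (fun k r => H r k j))//.
by apply: eq_bigr => k _; rewrite mxE.
Qed.

Lemma intmx_mulr (P : 'M[R]_N) (H : R -> 'M[R]_N) t :
  (forall i j, continuous (fun r => H r i j)) ->
  intmx (fun r => H r *m P) t = intmx H t *m P.
Proof.
move=> cH; apply/matrixP => i j; rewrite !mxE.
under eq_Rintegral do (rewrite mxE; under eq_bigr do rewrite mulrC).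
rewrite (@Rintegral_sum_cont _ (fun k => P k j) (fun k r => H r i k))//.
by apply: eq_bigr => k _; rewrite mxE mulrC.
Qed.

(** The interval is cut at [u], and its second piece is translated to the origin by substitution. *)
Lemma Rintegral_shift (h : R -> R) (t u : R) : continuous h -> 0 <= t -> 0 <= u ->
  \int[lam]_(r in `[0, u + t]) h r =
  \int[lam]_(r in `[0, u]) h r + \int[lam]_(r in `[0, t]) h (u + r).
Proof.
move=> ch t0 u0.
have := @Rintegral_itvB R h (BLeft 0) (BRight (u + t)) u (cont_integrable 0 (u + t) ch).
rewrite !bnd_simp lerDl => /(_ u0 t0).
rewrite Rintegral_itv_obnd_cbnd; last first.
  apply: integrableS (cont_integrable u (u + t) ch) => //.
  by apply: subset_itvr; rewrite bnd_simp.
move=> /eqP; rewrite subr_eq [X in _ == X]addrC => /eqP ->; congr (_ + _).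
pose s (x : R) := u + x.
have dsx x : is_derive x (1 : R) s 1.
  by rewrite (_ : s = cst u + id)//; apply: is_derive_eq; rewrite add0r.
have ds : derive1 s = cst 1.
  by apply/funext => x; rewrite derive1E derive_val.
rewrite /Rintegral; congr fine.
transitivity (\int[lam]_(x in `[s 0%R, s t]) (h x)%:E)%E; first by rewrite /s addr0.
rewrite (@integration_by_substitution_increasing R s h 0 t)//.
- by apply: eq_integral => x _; rewrite ds /= /s mulr1.
- by move=> x y _ _ xy; rewrite /s ltrD2l.
- by rewrite ds => x _; exact: cst_continuous.
- by rewrite ds; exact: is_cvg_cst.
- by rewrite ds; exact: is_cvg_cst.
- have cs : continuous s by move=> x; apply: cvgD; [exact: cvg_cst|exact: cvg_id].
  split; first by move=> x _; exact: ex_derive.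
    by apply: cvg_at_right_filter; exact: cs.
  by apply: cvg_at_left_filter; exact: cs.
- exact: continuous_subspaceT.
Qed.

Variables Q B : 'M[R]_N.
Hypothesis symQ : Q = Q^T.
Let F (r : R) := expmx (r *: B).
Let G (r : R) := F r *m Q *m (F r)^T.

Lemma continuous_expmx i j : continuous (fun r : R => expmx (r *: B) i j).
Proof.
move=> x; apply: differentiable_continuous; apply/derivable1_diffP.
by have [] := is_derive_expmx B x i j.
Qed.

Let continuous_G i j : continuous (fun r => G r i j).
Proof.
apply: continuous_mulmx => k l; last first.
  by under eq_fun do rewrite mxE; exact: continuous_expmx.
apply: continuous_mulmx => a b; first exact: continuous_expmx.
exact: cst_continuous.
Qed.

(** The controllability Gramian [t K(t)], written with a transposed exponential so that symmetry and
    conjugation are visible. *)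
Definition covmx (t : R) : 'M[R]_N := intmx (fun r => expmx (r *: B) *m Q *m (expmx (r *: B))^T) t.

Lemma Kmx_covmx t : 0 < t -> t *: Kmx Q B t = covmx t.
Proof.
move=> t0; rewrite /Kmx scalerA divff ?gt_eqF// scale1r.
apply/matrixP => i j; rewrite !mxE; apply: eq_Rintegral => r _.
by rewrite trmx_expmx.
Qed.

Lemma trmx_covmx t : (covmx t)^T = covmx t.
Proof.
apply/matrixP => i j; rewrite !mxE; apply: eq_Rintegral => r _.
transitivity ((G r)^T i j); first by rewrite [RHS]mxE.
by rewrite /G trmx_mul trmx_mul trmxK -symQ mulmxA.
Qed.

(** On the part of the integral beyond [u], [e^((u+r)B) = e^(uB) e^(rB)] lets the constant factors
    be pulled out on both sides. *)
Lemma covmxD (t u : R) : 0 <= t -> 0 <= u ->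
  covmx (u + t) = covmx u + expmx (u *: B) *m covmx t *m (expmx (u *: B))^T.
Proof.
move=> t0 u0; rewrite /covmx -/(F u) -intmx_mull// -intmx_mulr; last first.
  by apply: continuous_mulmx => // i j; exact: cst_continuous.
apply/matrixP => i j; rewrite [RHS]mxE /intmx [LHS]mxE [X in _ = X + _]mxE [X in _ = _ + X]mxE.
rewrite (Rintegral_shift (@continuous_G i j) t0 u0).
apply: (congr1 (fun x => _ + x)); apply: eq_Rintegral => r _.
have -> : G (u + r) = F u *m G r *m (F u)^T; last by [].
by rewrite /G /F expmxD trmx_mul !mulmxA.
Qed.

End covariance.

(** * Growth of the volume function *)

Section det_monotone.
Context (R : realType) (n : nat).
Implicit Types A C S : 'M[R]_n.

(** A Gaussian integral is [pi^(n/2)] times the determinant to the power -1/2, so a pointwise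
    comparison of Gaussians integrates to one of determinants. It is used with weights [(1, 0)] and
    [(1/2, 1/2)]. *)
Lemma gauss_det_le A C (a c : R) : 0 <= a -> 0 <= c -> a + c = 1 ->
  A^T = A -> pdmx A -> C^T = C -> pdmx C -> forall D : 'M[R]_n, D^T = D -> pdmx D ->
  (forall v : 'cV[R]_n, expR (- dotv (D *m v) v) <=
     a * expR (- dotv (A *m v) v) + c * expR (- dotv (C *m v) v)) ->
  \det A <= \det C -> \det A <= \det D.
Proof.
move=> a0 c0 ac1 sA pA sC pC D sD pD h AC.
have [dA /(_ 0) IA] := gaussian_integral sA pA.
have [dC /(_ 0) IC] := gaussian_integral sC pC.
have [dD /(_ 0) ID] := gaussian_integral sD pD.
have mq (E : 'M[R]_n) : measurable_fun setT (fun x : n.-tuple (measurableTypeR R) =>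
    (expR (- dotv (E *m (tcol x - 0)) (tcol x - 0)))%:E).
  apply/measurable_EFinP/measurableT_comp => //; apply: measurable_funN.
  exact: measurable_quad.
have : (\int[borel_lebesgue R n]_x (expR (- dotv (D *m (tcol x - 0)) (tcol x - 0)))%:E <=
   \int[borel_lebesgue R n]_x
     (a%:E * (expR (- dotv (A *m (tcol x - 0)) (tcol x - 0)))%:E +
      c%:E * (expR (- dotv (C *m (tcol x - 0)) (tcol x - 0)))%:E))%E.
  apply: ge0_le_integral_nomeas => x _; first by rewrite lee_fin expR_ge0.
  by rewrite -!EFinM -EFinD lee_fin.
rewrite ge0_integralD//; last 4 first.
- by move=> x _; rewrite -EFinM lee_fin mulr_ge0 ?expR_ge0.
- by apply: measurable_funeM; exact: mq.
- by move=> x _; rewrite -EFinM lee_fin mulr_ge0 ?expR_ge0.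
- by apply: measurable_funeM; exact: mq.
rewrite !ge0_integralZl_EFin//; try exact: mq; try by move=> x _; rewrite lee_fin expR_ge0.
rewrite IA IC ID -!EFinM -EFinD lee_fin => hD.
have pn : 0 < pi ^+ n :> R by rewrite exprn_gt0 ?pi_gt0.
have : Num.sqrt (pi ^+ n / \det D) <= Num.sqrt (pi ^+ n / \det A).
  apply: le_trans hD _.
  have : Num.sqrt (pi ^+ n / \det C) <= Num.sqrt (pi ^+ n / \det A).
    by rewrite ler_sqrt ?divr_ge0 ?(ltW pn) ?(ltW dA)// ler_pM2l// lef_pV2.
  move/(ler_wpM2l c0)/(lerD (lexx (a * Num.sqrt (pi ^+ n / \det A)))).
  by rewrite -mulrDl ac1 mul1r.
by rewrite ler_sqrt ?divr_ge0 ?(ltW pn) ?(ltW dA)// ler_pM2l// lef_pV2.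
Qed.

(** Adding a nonnegative form to the exponent lowers the Gaussian pointwise. *)
Lemma det_le_add A S : A^T = A -> pdmx A -> S^T = S -> psdmx S ->
  \det A <= \det (A + S).
Proof.
move=> sA pA sS pS.
apply: (@gauss_det_le A A 1 0) => //; rewrite ?addr0//.
- by rewrite linearD/= sA sS.
- by move=> u u0; rewrite mulmxDl dotvDl ltr_pwDl// pA.
- move=> v; rewrite mul1r mul0r addr0 ler_expR lerN2 mulmxDl dotvDl lerDl.
  exact: pS.
Qed.

(* Convexity of the exponential bounds the Gaussian of [(A + C) / 2] by the
   mean of the Gaussians of [A] and [C]. *)
Lemma det_add_ge A C : A^T = A -> pdmx A -> C^T = C -> pdmx C ->
  \det A <= \det C -> 2 ^+ n * \det A <= \det (A + C).
Proof.
move=> sA pA sC pC AC.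
have : \det A <= \det (2^-1 *: (A + C)).
  apply: (@gauss_det_le A C 2^-1 2^-1) => //.
  - by rewrite -[RHS](_ : 2^-1 + 2^-1 = 1)//; field.
  - by rewrite linearZ/= linearD/= sA sC.
  - by apply: pdmxZ => // u u0; rewrite mulmxDl dotvDl addr_gt0 ?pA ?pC.
  move=> v; rewrite -scalemxAl dotvZl mulmxDl dotvDl.
  set x := dotv _ _; set y := dotv _ _.
  have -> : - (2^-1 * (x + y)) = - x / 2 + - y / 2 by field.
  rewrite expRD.
  have ex (z : R) : expR (- z) = expR (- z / 2) ^+ 2.
    by rewrite expr2 -expRD; congr expR; field.
  rewrite (ex x) (ex y).
  have := sqr_ge0 (expR (- x / 2) - expR (- y / 2)); nra.
rewrite detZ exprVn mulrC ler_pdivlMr ?exprn_gt0// mulrC.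
exact.
Qed.

End det_monotone.

(** * Linear growth of the volume function *)

Section growth.
Context (R : realType) (N : nat) (Q B : 'M[R]_N).
Hypothesis N2 : (2 <= N)%N.
Hypothesis symQ : Q = Q^T.
Hypothesis Kpd : forall t : R, 0 < t -> pdmx (Kmx Q B t).
Hypothesis trB : 0 <= \tr B.

Lemma trmx_Kmx (t : R) : 0 < t -> (Kmx Q B t)^T = Kmx Q B t.
Proof.
move=> t0; have -> : Kmx Q B t = t^-1 *: covmx Q B t.
  by rewrite -Kmx_covmx// scalerA mulVf ?gt_eqF// scale1r.
by rewrite linearZ/= trmx_covmx.
Qed.

Lemma pdmx_covmx (t : R) : 0 < t -> pdmx (covmx Q B t).
Proof. by move=> t0; rewrite -Kmx_covmx//; apply: pdmxZ => //; exact: Kpd. Qed.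

Lemma psdmx_conj (P A : 'M[R]_N) : pdmx A -> psdmx (P *m A *m P^T).
Proof.
move=> pA u; rewrite -!mulmxA dotv_mulmx.
have [->|v0] := eqVneq (P^T *m u) 0; last exact/ltW/pA.
by rewrite mulmx0 /dotv big1// => i _; rewrite mxE mul0r.
Qed.

Lemma pdmx_conj (P A : 'M[R]_N) : P \in unitmx -> pdmx A -> pdmx (P *m A *m P^T).
Proof.
move=> uP pA u u0; rewrite -!mulmxA dotv_mulmx; apply: pA.
apply: contraNneq u0 => h; apply/eqP.
have uPT : P^T \in unitmx by rewrite unitmx_tr.
by rewrite -(mulKmx uPT u) h mulmx0.
Qed.

Lemma det_covmx_le (t u : R) : 0 < t -> t <= u ->
  \det (covmx Q B t) <= \det (covmx Q B u).
Proof.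
move=> t0; rewrite le_eqVlt => /predU1P[->//|tu].
have ut : 0 < u - t by rewrite subr_gt0.
have -> : u = t + (u - t) by rewrite addrC subrK.
rewrite covmxD ?(ltW t0) ?(ltW ut)//; apply: det_le_add.
- exact: trmx_covmx.
- exact: pdmx_covmx.
- by rewrite !trmx_mul trmxK trmx_covmx// mulmxA.
- by apply: psdmx_conj; exact: pdmx_covmx.
Qed.

Lemma det_covmx_double (t : R) : 0 < t ->
  4 * \det (covmx Q B t) <= \det (covmx Q B (t + t)).
Proof.
move=> t0; have [d0 _] := gaussian_integral (trmx_covmx B symQ t) (pdmx_covmx t0).
have d1 := det_expmx_ge1 trB (ltW t0).
have uF : expmx (t *: B) \in unitmx by rewrite unitmxE unitfE gt_eqF//; lra.
rewrite covmxD ?(ltW t0)//.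
(* Here [N >= 2] enters through [2^N >= 4]: a factor 4 per doubling of time becomes a factor 2 for
   the square root, that is, linear growth. *)
apply: (@le_trans _ _ (2 ^+ N * \det (covmx Q B t))).
  rewrite ler_pM2r//; have -> : 4 = 2 ^+ 2 :> R by ring.
  by apply: ler_weXn2l => //; rewrite ler1n.
apply: det_add_ge.
- exact: trmx_covmx.
- exact: pdmx_covmx.
- by rewrite !trmx_mul trmxK trmx_covmx// mulmxA.
- by apply: pdmx_conj => //; exact: pdmx_covmx.
- rewrite !det_mulmx det_tr mulrC mulrA ler_peMl ?(ltW d0)//.
  by rewrite mulr_ege1.
Qed.

(** The time is halved until it lies in [[1, 2]], where monotonicity suffices because [t / 2 <= 1];
    each halving is paid for by the doubling estimate. *)
Lemma det_covmx_growth (t : R) : 1 <= t ->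
  (t / 2) ^+ 2 * \det (covmx Q B 1) <= \det (covmx Q B t).
Proof.
have d1 : 0 < \det (covmx Q B 1).
  by have [] := gaussian_integral (trmx_covmx B symQ 1) (pdmx_covmx ltr01).
have main k : forall t : R, 1 <= t <= 2 ^+ k ->
    (t / 2) ^+ 2 * \det (covmx Q B 1) <= \det (covmx Q B t).
  elim: k => [|k IH] {}t /andP[t1 tk].
    apply: le_trans (det_covmx_le ltr01 t1); rewrite ler_piMl ?(ltW d1)//.
    by apply: exprn_ile1; rewrite expr0 in tk; lra.
  have [t2|t2] := leP t 2.
    apply: le_trans (det_covmx_le ltr01 t1); rewrite ler_piMl ?(ltW d1)//.
    by apply: exprn_ile1; lra.
  have th : 1 <= t / 2 <= 2 ^+ k by move: tk; rewrite exprS; lra.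
  have t20 : 0 < t / 2 by lra.
  have := det_covmx_double t20; rewrite -splitr; apply: le_trans.
  by have := IH _ th; lra.
move=> t1; apply: (main (Num.truncn t).+1); rewrite t1/=.
apply: (@le_trans _ _ (Num.truncn t).+1%:R); first exact/ltW/truncnS_gt.
by rewrite -natrX ler_nat ltnW// ltn_expl.
Qed.

Lemma vol_growth : 0 < vol Q B 1 -> forall t : R, 1 <= t ->
  vol Q B 1 / 2 * t <= vol Q B t.
Proof.
move=> V1 t t1; have t0 : 0 < t by lra.
have o0 : 0 <= omega R N by exact: fine_ge0.
rewrite /vol !Kmx_covmx//.
have := det_covmx_growth t1.
rewrite -ler_sqrt; last first.
  by have [/ltW] := gaussian_integral (trmx_covmx B symQ t) (pdmx_covmx t0).
rewrite sqrtrM ?sqr_ge0// sqrtr_sqr ger0_norm; last by lra.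
by move=> /(ler_wpM2l o0); apply: le_trans; lra.
Qed.

(** Linear growth bounds the integrand for exponent 1 by a multiple of [t^(-3/2)], whose
    antiderivative [F] tends to 0 at infinity. *)
Lemma one_Sigma_infty : 0 < vol Q B 1 -> Sigma_infty Q B 1.
Proof.
move=> V1; split => //.
set c := vol Q B 1 / 2.
have c0 : 0 < c by rewrite divr_gt0.
apply: (@le_lt_trans _ _ (\int[lebesgue_measure]_(t in `[1%R, +oo[)
    (c^-1 * t `^ (- (3 / 2)))%:E)%E).
  apply: ge0_le_integral_nomeas => t; rewrite /= in_itv/= andbT => t1.
    have Vct : c * t <= vol Q B t := vol_growth V1 t1.
    move: (vol Q B t) Vct => v Vct; rewrite lee_fin divr_ge0 ?powR_ge0//.
    by apply: le_trans Vct; rewrite mulr_ge0 ?(ltW c0)//; lra.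
  have t0 : 0 < t by lra.
  have ct0 : 0 < c * t by rewrite mulr_gt0.
  have Vct : c * t <= vol Q B t := vol_growth V1 t1.
  move: (vol Q B t) Vct => v Vct; rewrite lee_fin.
  apply: (@le_trans _ _ (t `^ (1 / 2 - 1) / (c * t))).
    apply: ler_wpM2l; first exact: powR_ge0.
    by rewrite lef_pV2// posrE (lt_le_trans ct0).
  rewrite invfM mulrCA -[in t^-1](powRr1 (ltW t0)) -powRN -powRD; last first.
    by apply/implyP => _; rewrite gt_eqF.
  by rewrite ler_pM2l ?invr_gt0// (_ : _ + -1 = - (3 / 2))//; field.
pose F (t : R) := - (2 / c) * t `^ (- (1 / 2)).
have dF (x : R) : 0 < x -> is_derive x (1 : R) F (c^-1 * x `^ (- (3 / 2))).
  move=> x0; have h := is_derive1_powR (- (1 / 2)) x0.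
  have := @is_deriveZ R R R _ (- (2 / c)) x 1 _ h.
  rewrite (_ : (- (2 / c)) *: _ = c^-1 * x `^ (- (3 / 2)))//.
  rewrite /GRing.scale/= (_ : - (1 / 2) - 1 = - (3 / 2)); last by field.
  by field; rewrite gt_eqF.
rewrite (@ge0_continuous_FTC2y R _ F 1 0).
- by rewrite -EFinB ltry.
- by move=> x x1; rewrite mulr_ge0 ?invr_ge0 ?powR_ge0// ltW.
- apply: continuous_in_subspaceT => x; rewrite inE/= in_itv/= andbT => x1.
  have px : {for x, continuous (fun y : R => y `^ (- (3 / 2)))}.
    apply: differentiable_continuous; apply/derivable1_diffP.
    by have [] := is_derive1_powR (- (3 / 2)) (lt_le_trans ltr01 x1).
  exact: cvgMl_tmp.
- rewrite -(mulr0 (- (2 / c))); apply: cvgMl_tmp.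
  apply/cvgrPdist_le => e e0; near=> x.
  have x0 : 0 < x by near: x; exact: nbhs_pinfty_gt.
  have ex : e `^ (- 2) <= x by near: x; apply: nbhs_pinfty_ge; rewrite num_real.
  rewrite sub0r normrN ger0_norm ?powR_ge0// powRN invf_ple ?posrE ?powR_gt0//.
  rewrite -(@powR_mono_le _ 2) ?invr_ge0 ?powR_ge0 ?(ltW e0)// -powRrM.
  rewrite (_ : 1 / 2 * 2 = 1) ?powRr1 ?(ltW x0)//; last by field.
- by move=> x x1; have [] := dF x (lt_trans ltr01 x1).
- have F1 : {for 1, continuous F}.
    by apply: differentiable_continuous; apply/derivable1_diffP; have [] := dF 1 ltr01.
  exact: cvg_at_right_filter.
- move=> x; rewrite in_itv/= andbT => x1.
  by rewrite derive1E; have [_ ->] := dF x (lt_trans ltr01 x1).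
Unshelve. all: by end_near. Qed.

Lemma dim_infty_ge1 (D : R) : 0 < vol Q B 1 -> dim_infty Q B = D%:E -> 1 <= D.
Proof.
move=> V1 h; rewrite -lee_fin -h; apply: ereal_sup_ubound.
by exists 1 => //; exact: one_Sigma_infty.
Qed.

End growth.

(** * The embedding and the isoperimetric inequality *)

Lemma sub_min_lipschitz (R : realDomainType) (u v c : R) :
  `|(u - Num.min u c) - (v - Num.min v c)| <= `|u - v|.
Proof.
have [uv|vu] := ger0P (u - v); rewrite ler_norml;
  by case: (leP u c) => uc; case: (leP v c) => vc; apply/andP; split; lra.
Qed.

Lemma lt_sub_min (R : realDomainType) (u c l : R) : 0 < l ->
  (l < u - Num.min u c) = (l + c < u).
Proof. by move=> l0; case: (leP u c) => uc; apply/idP/idP; lra. Qed.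

(** Clamping a signed value splits its absolute value into a truncation and an excess, so levels and
    seminorms can be handled on absolute values. *)
Lemma abs_sub_clamp (R : realType) (u c : R) : 0 <= c ->
  `|u - Num.max (- c) (Num.min u c)| = `|u| - Num.min `|u| c /\
  `|Num.max (- c) (Num.min u c)| = Num.min `|u| c.
Proof.
move=> c0; have [u0|u0] := ger0P u.
  have -> : Num.max (- c) (Num.min u c) = Num.min u c.
    by apply/max_idPr; rewrite le_min; apply/andP; split; lra.
  have m0 : 0 <= Num.min u c by rewrite le_min u0.
  by rewrite !ger0_norm// subr_ge0 ge_min lexx.
have -> : Num.min u c = u by apply/min_idPl; lra.
have [uc|uc] := leP (- c) u.
  by rewrite subrr normr0 ltr0_norm//; split; [|]; rewrite (min_idPl _) ?subrr//; lra.
by rewrite normrN (ger0_norm c0) ltr0_norm ?subr_lt0//; split; rewrite (min_idPr _)//; lra.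
Qed.

Lemma Lnorm_indic (d : measure_display) (T : measurableType d) (R : realType)
    (mu : {measure set T -> \bar R}) (E : set T) (q : R) : measurable E -> 0 < q ->
  ('N[mu]_(q%:E)[EFin \o \1_E] = mu E `^ q^-1)%E.
Proof.
move=> mE q0; rewrite unlock; congr (_ `^ _)%E.
rewrite -[X in _ = mu X]setIT -integral_indic//; apply: eq_integral => x _.
rewrite /= indicE; case: (x \in E) => /=; first by rewrite normr1 powR1.
by rewrite normr0 powR0 ?gt_eqF.
Qed.

Section main.
Context (R : realType) (N : nat) (D0 Dinf s gamma : R).
Hypothesis hN : (2 <= N)%N.
Hypothesis hs : 0 < s < 1 / 2.
Hypothesis hD : Dinf < D0.
Hypothesis hg : 0 < gamma.
Local Notation mu := (lebesgue_Rn R N).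

(* The summand 1 makes [kappa] positive without knowing [omega R N > 0]. *)
Let kappa : R := `|omega R N * (4 * pi) `^ (- (N%:R / 2))| + 1.
(** Chosen so that [a m <= V(t) / gamma] means [kappa m / V(t) <= 1/2]; its inverse is the measure
    separating small from large level sets. *)
Let a : R := 2 * kappa / gamma.

Let kappa_gt0 : 0 < kappa. Proof. by rewrite /kappa ltr_wpDl. Qed.
Let a_gt0 : 0 < a. Proof. by rewrite divr_gt0// mulr_gt0. Qed.

(** Introduced before [Q] and [B], so that it depends on [N], [s], [gamma] and [D] only. *)
Definition besov_const (D : R) : R := embedding_const a D s.

Lemma besov_const_gt0 D : 0 < besov_const D.
Proof. exact: embedding_const_gt0. Qed.

Section operator.
Variables Q B : 'M[R]_N.
Hypothesis symQ : Q = Q^T.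
Hypothesis Kpd : forall t : R, 0 < t -> pdmx (Kmx Q B t).
Hypothesis trB : 0 <= \tr B.
Hypothesis hDinf : dim_infty Q B = Dinf%:E.
Hypothesis hV : forall t : R, 0 < t ->
  gamma * Num.min (t `^ (D0 / 2)) (t `^ (Dinf / 2)) <= vol Q B t.

Let V_gt0 (t : R) : 0 < t -> 0 < vol Q B t.
Proof.
by move=> t0; apply: lt_le_trans (hV t0); rewrite mulr_gt0// lt_min !powR_gt0.
Qed.

Lemma Dinf_gt2s : 2 * s < Dinf.
Proof.
have := dim_infty_ge1 hN symQ Kpd trB (V_gt0 ltr01) hDinf.
by case/andP: hs => _; lra.
Qed.

Let p (t : R) (X Y : Rn R N) : R := heat_kernel Q B X Y t.
Let b (t : R) : R := kappa / vol Q B t.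
Let seminorm := nonlocal_seminorm (lebesgue_Rn_sf R N) p s.

Let p_ge0 (t : R) X Y : 0 < t -> 0 <= p t X Y.
Proof. by move=> t0; apply: heat_kernel_ge0; exact: V_gt0. Qed.

Let p_meas (t : R) X : 0 < t -> measurable_fun setT (p t X).
Proof.
by move=> t0; apply: measurable_heat_kernel => //; [exact: trmx_Kmx|exact: Kpd].
Qed.

Let p_int (t : R) X : 0 < t -> (\int[lebesgue_Rn_sf R N]_Y (p t X Y)%:E = 1)%E.
Proof.
by move=> t0; apply: integral_heat_kernel => //; [exact: trmx_Kmx|exact: Kpd|exact: V_gt0].
Qed.

Let p_le (t : R) X Y : 0 < t -> p t X Y <= b t.
Proof.
move=> t0; apply: (le_trans (heat_kernel_le t0 (V_gt0 t0) X Y)).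
rewrite ler_pM2r ?invr_gt0 ?V_gt0// /kappa.
by apply: le_trans (ler_norm _) _; rewrite lerDl.
Qed.

Lemma besov_seminormE f : besov_seminorm Q B (2 * s) 1 f = seminorm f.
Proof.
rewrite /besov_seminorm invr1 poweRe1; last first.
  apply: integral_ge0 => t; rewrite /= in_itv/= andbT => t0.
  apply: mule_ge0; first by rewrite lee_fin invr_ge0 powR_ge0.
  apply: integral_ge0 => X _; apply: integral_ge0 => Y _.
  by rewrite lee_fin mulr_ge0 ?powR_ge0//; exact: p_ge0.
apply: eq_integral => t _; rewrite (_ : 2 * s * 1 / 2 + 1 = s + 1); last by field.
apply: (congr1 (fun z => (_ * z)%E)).
apply: eq_integral => X _; apply: eq_integral => Y _.
by rewrite powRr1.
Qed.

Let level_bound (m : \bar R) (t : R) : 0 < t -> (0 <= m)%E ->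
  (a%:E * m <= (Num.min (t `^ (D0 / 2)) (t `^ (Dinf / 2)))%:E)%E ->
  ((b t)%:E * m <= (2^-1)%:E)%E.
Proof.
move=> t0; case: m => [r| |]//; last by rewrite gt0_muley ?lte_fin// leye_eq.
rewrite -!EFinM !lee_fin => r0 ar; rewrite /b mulrAC ler_pdivrMr ?V_gt0//.
have : gamma * (a * r) <= vol Q B t.
  by apply: le_trans (hV t0); rewrite ler_pM2l.
have -> : gamma * (a * r) = 2 * (kappa * r).
  by rewrite /a; field; rewrite gt_eqF.
lra.
Qed.

(** For [t <= 1] the power with [D0] is the smaller one; for [t > 1] the power with [Dinf] is at
    least 1, hence at least [a m]. *)
Let small_levels (m : \bar R) (t : R) : 0 < t -> (0 <= m)%E -> (m <= (a^-1)%:E)%E ->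
  (a%:E * m <= (t `^ (D0 / 2))%:E)%E -> ((b t)%:E * m <= (2^-1)%:E)%E.
Proof.
move=> t0 m0 ma am; apply: level_bound => //.
rewrite EFin_min le_min am/=.
have [t1|t1] := leP t 1.
  apply: le_trans am _; rewrite lee_fin.
  by apply: ger_powR; rewrite ?t0// ler_pM2r// ltW.
apply: (@le_trans _ _ 1%E).
  apply: (@le_trans _ _ (a%:E * (a^-1)%:E)%E).
    by apply: lee_wpmul2l => //; rewrite lee_fin ltW.
  by rewrite -EFinM divff ?gt_eqF.
rewrite lee_fin -[leLHS](powRr0 t); apply: ler_powR; first exact: ltW.
by have := Dinf_gt2s; case/andP: hs; lra.
Qed.

(** From [1 < a m <= t^(Dinf/2)] it follows that [t >= 1], where the power with [Dinf] is the
    smaller one. *)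
Let large_levels (m : \bar R) (t : R) : 0 < t -> ((a^-1)%:E < m)%E ->
  (a%:E * m <= (t `^ (Dinf / 2))%:E)%E -> ((b t)%:E * m <= (2^-1)%:E)%E.
Proof.
move=> t0 ma am; have m0 : (0 <= m)%E.
  by apply: ltW; apply: lt_trans ma; rewrite lte_fin invr_gt0.
apply: level_bound => //; rewrite EFin_min le_min am andbT.
apply: (le_trans am); rewrite lee_fin; apply: ler_powR; last by rewrite ler_pM2r// ltW.
rewrite leNgt; apply/negP => t1.
have : (1 < a%:E * m)%E.
  have -> : 1%E = (a%:E * (a^-1)%:E)%E by rewrite -EFinM divff ?gt_eqF.
  by rewrite lte_pmul2l// lte_fin.
rewrite ltNge => /negP; apply; apply: le_trans am _; rewrite lee_fin.
rewrite -[leRHS](powRr0 t); apply: ger_powR; first by rewrite t0 ltW.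
by have := Dinf_gt2s; case/andP: hs; lra.
Qed.

Lemma embedding_small (g : Rn R N -> R) : measurable_fun setT g ->
  (forall x, 0 <= g x) -> (\int[mu]_x (g x)%:E < +oo)%E ->
  (forall l : R, 0 < l -> (mu [set x | (l < g x)%R] <= (a^-1)%:E)%E) ->
  ((besov_const D0)%:E * 'N[mu]_((D0 / (D0 - 2 * s))%:E)[EFin \o g] <= seminorm g)%E.
Proof.
move=> mg g0 gfin gl.
apply: (@nonlocal_embedding _ _ _ (lebesgue_Rn_sf R N) p b) => //.
- by case/andP: hs.
- by apply: lt_trans hD; exact: Dinf_gt2s.
- by move=> l t l0 t0; apply: small_levels => //; exact: gl.
Qed.

(** The null alternative accounts for levels beyond the maximal height of a truncated function,
    where the level condition holds trivially. *)
Lemma embedding_large (g : Rn R N -> R) : measurable_fun setT g ->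
  (forall x, 0 <= g x) -> (\int[mu]_x (g x)%:E < +oo)%E ->
  (forall l : R, 0 < l -> (mu [set x | (l < g x)%R] = 0 \/
     (a^-1)%:E < mu [set x | (l < g x)%R])%E) ->
  ((besov_const Dinf)%:E * 'N[mu]_((Dinf / (Dinf - 2 * s))%:E)[EFin \o g] <= seminorm g)%E.
Proof.
move=> mg g0 gfin gl.
apply: (@nonlocal_embedding _ _ _ (lebesgue_Rn_sf R N) p b) => //.
- by case/andP: hs.
- exact: Dinf_gt2s.
- move=> l t l0 t0; case: (gl _ l0) => [m0 _|ml]; last exact: large_levels.
  by rewrite [X in (_ * X)%E]m0 mule0 lee_fin.
Qed.

(** The positive level sets of an indicator are [E] or empty, so a single embedding applies to all
    of it, chosen by comparing the measure of [E] with [1 / a]. *)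
Lemma isoperimetric (E : set (Rn R N)) : measurable E -> (mu E < +oo)%E ->
  ((Num.min (besov_const D0) (besov_const Dinf))%:E *
    Order.min (mu E `^ ((D0 - 2 * s) / D0)) (mu E `^ ((Dinf - 2 * s) / Dinf))
    <= perimeter Q B s E)%E.
Proof.
move=> mE Efin; rewrite /perimeter besov_seminormE.
have Ds := Dinf_gt2s; have hD' := hD; have s0 : 0 < s by case/andP: hs.
have q0 : 0 < D0 / (D0 - 2 * s) by apply: divr_gt0; lra.
have q1 : 0 < Dinf / (Dinf - 2 * s) by apply: divr_gt0; lra.
have m1 : measurable_fun setT (\1_E : Rn R N -> R) by exact: measurable_indic.
have int1 : (\int[mu]_x (\1_E x)%:E < +oo)%E by rewrite integral_indic// setIT.
have lev (l : R) : 0 < l -> [set x | l < (\1_E : Rn R N -> R) x] = (if l < 1 then E else set0).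
  move=> l0; apply/seteqP; split => x /=; rewrite indicE.
    case: (boolP (x \in E)) => /= [/set_mem Ex ->//|_].
    by rewrite ltNge ltW.
  by case: ifP => // l1 Ex; rewrite mem_set.
have c0 : (0 <= (Num.min (besov_const D0) (besov_const Dinf))%:E)%E.
  by rewrite lee_fin le_min; apply/andP; split; apply/ltW/besov_const_gt0.
have [Ea|Ea] := leP (mu E) (a^-1)%:E.
  have := @embedding_small \1_E m1 (fun x => ler0n _ _) int1.
  rewrite Lnorm_indic//.
  rewrite [(D0 / _)^-1]invf_div => h; apply: le_trans (h _); last first.
    move=> l l0; rewrite lev//; case: ifP => _; first exact: Ea.
    by rewrite measure0 lee_fin invr_ge0 ltW.
  apply: lee_pmul; first exact: c0.
  - by rewrite le_min !poweR_ge0.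
  - by rewrite lee_fin ge_min; apply/orP; left; exact: lexx.
  - by rewrite ge_min; apply/orP; left; exact: lexx.
have := @embedding_large \1_E m1 (fun x => ler0n _ _) int1.
rewrite Lnorm_indic//.
rewrite [(Dinf / _)^-1]invf_div => h; apply: le_trans (h _); last first.
  move=> l l0; rewrite lev//; case: ifP => _; [by right|left].
  by rewrite measure0.
apply: lee_pmul; first exact: c0.
- by rewrite le_min !poweR_ge0.
- by rewrite lee_fin ge_min; apply/orP; right; exact: lexx.
- by rewrite ge_min; apply/orP; right; exact: lexx.
Qed.

(** Clamping at the height [sg] where the distribution function of [|f|] crosses [1 / a] gives [f2],
    and [f1] is the rest. Level sets of [|f1|] are level sets of [|f|] above [sg], hence small;
    those of [|f2|] are level sets of [|f|] below [sg], hence large, or empty. *)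
Lemma besov_embedding (f : Rn R N -> R) : besov Q B (2 * s) 1 f ->
  sum_space (D0 / (D0 - 2 * s)) (Dinf / (Dinf - 2 * s)) f /\
  (sum_norm (D0 / (D0 - 2 * s)) (Dinf / (Dinf - 2 * s)) f <=
    ((besov_const D0)^-1 + (besov_const Dinf)^-1)%:E * besov_seminorm Q B (2 * s) 1 f)%E.
Proof.
rewrite /besov/= besov_seminormE => -[fL1 Nfin].
have Ds := Dinf_gt2s; have hD' := hD; have s0 : 0 < s by case/andP: hs.
have mf : measurable_fun setT f by move: fL1; rewrite inE => /andP[]; rewrite !inE.
have mnf : measurable_fun setT (fun x => `|f x|) by exact: measurableT_comp.
have intf : (\int[mu]_x (`|f x|)%:E < +oo)%E.
  move: fL1; rewrite inE => /andP[_]; rewrite !inE/= /finite_norm Lnorm1.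
  by [].
pose m (l : R) := mu [set x | l < `|f x|].
have mlev (l : R) : measurable [set x | l < `|f x|].
  rewrite -[X in measurable X]setTI (_ : [set x | _] = (fun x => `|f x|) @^-1` `]l, +oo[).
    by apply: mnf => //; exact: measurable_itv.
  by apply/seteqP; split => x /=; rewrite in_itv/= andbT.
pose S := [set l : R | 0 <= l /\ (m l <= (a^-1)%:E)%E].
have m_noninc (l l' : R) : l <= l' -> (m l' <= m l)%E.
  move=> ll'; apply: le_measure; rewrite ?inE; [exact: mlev..|].
  by move=> x /=; exact: le_lt_trans.
have S0 : S !=set0.
  have I0 : (0 <= \int[mu]_x (`|f x|)%:E)%E by apply: integral_ge0 => x _; rewrite lee_fin.
  case II : (\int[mu]_x (`|f x|)%:E)%E intf I0 => [I| |]// _; rewrite lee_fin => I0.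
  have l0 : 0 < I * a + 1 by rewrite ltr_wpDl// mulr_ge0// ltW.
  (* At this level Chebyshev's inequality gives measure at most [I / (I a + 1) <= 1 / a]; the
     summand 1 keeps the level positive when [I = 0]. *)
  exists (I * a + 1); split; first exact: ltW.
  have := ge0_chebyshev mu mnf (fun x => normr_ge0 _) (ltr01 : 0 < 1 :> R) l0.
  under eq_integral do rewrite powRr1//.
  rewrite II powRr1 ?(ltW l0)// -/(m _) => h.
  have : (m (I * a + 1)%R <= (I / (I * a + 1))%:E)%E.
    by rewrite EFinM lee_pdivlMr// muleC.
  move/le_trans; apply; rewrite lee_fin ler_pdivrMr// mulrDr mulr1 mulrCA mulVf ?gt_eqF// mulr1.
  by rewrite lerDl invr_ge0 ltW.
have Slb : has_lbound S by exists 0 => l [].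
pose sg := inf S.
have sg0 : 0 <= sg by apply: lb_le_inf => // l [].
have m_above (l : R) : sg < l -> (m l <= (a^-1)%:E)%E.
  move=> /(inf_lt S0)[l' [_ ml'] l'l]; apply: le_trans ml'.
  by apply: m_noninc; exact: ltW.
have m_below (l : R) : 0 <= l -> l < sg -> ((a^-1)%:E < m l)%E.
  move=> l0 lsg; rewrite ltNge; apply/negP => ml.
  by move: lsg; rewrite ltNge => /negP; apply; apply: ge_inf.
pose f2 x := Num.max (- sg) (Num.min (f x) sg).
pose f1 x := f x - f2 x.
have mf2 : measurable_fun setT f2.
  apply: measurable_maxr; first exact: measurable_cst.
  by apply: measurable_minr; [exact: mf|exact: measurable_cst].
have mf1 : measurable_fun setT f1 by exact: measurable_funB.
have mnf1 : measurable_fun setT (fun x => `|f1 x|) by exact: measurableT_comp.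
have mnf2 : measurable_fun setT (fun x => `|f2 x|) by exact: measurableT_comp.
have f1E x : `|f1 x| = `|f x| - Num.min `|f x| sg by exact: (abs_sub_clamp _ sg0).1.
have f2E x : `|f2 x| = Num.min `|f x| sg by exact: (abs_sub_clamp _ sg0).2.
have int1 : (\int[mu]_x (`|f1 x|)%:E < +oo)%E.
  apply: le_lt_trans intf; apply: ge0_le_integral_nomeas => x _; rewrite lee_fin//.
  by rewrite f1E lerBlDr lerDl le_min normr_ge0.
have int2 : (\int[mu]_x (`|f2 x|)%:E < +oo)%E.
  apply: le_lt_trans intf; apply: ge0_le_integral_nomeas => x _; rewrite lee_fin//.
  by rewrite f2E ge_min lexx.
have E1 : ((besov_const D0)%:E * 'N[mu]_((D0 / (D0 - 2 * s))%:E)[EFin \o f1] <= seminorm f)%E.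
  rewrite -Lnorm_abse.
  have := @embedding_small (fun x => `|f1 x|) mnf1
    (fun x => normr_ge0 _) int1.
  move=> h; apply: le_trans (h _) _ => [l l0|].
    have -> : [set x | l < `|f1 x|] = [set x | l + sg < `|f x|].
      by apply/seteqP; split => x /=; rewrite f1E lt_sub_min.
    by apply: m_above; rewrite ltrDr.
  apply: le_nonlocal_seminorm => // x y; rewrite !f1E.
  by apply: le_trans (sub_min_lipschitz _ _ _) _; exact: ler_dist_dist.
have E2 : ((besov_const Dinf)%:E * 'N[mu]_((Dinf / (Dinf - 2 * s))%:E)[EFin \o f2] <= seminorm f)%E.
  rewrite -Lnorm_abse.
  have := @embedding_large (fun x => `|f2 x|) mnf2
    (fun x => normr_ge0 _) int2.
  move=> h; apply: le_trans (h _) _ => [l l0|].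
    have [ls|sl] := ltP l sg.
      right; have -> : [set x | l < `|f2 x|] = [set x | l < `|f x|].
        by apply/seteqP; split => x /=; rewrite f2E lt_min ls andbT.
      by apply: m_below => //; exact: ltW.
    left; have -> : [set x | l < `|f2 x|] = set0.
      by apply/seteqP; split => x //=; rewrite f2E lt_min [l < sg]ltNge sl andbF.
    by rewrite measure0.
  apply: le_nonlocal_seminorm => // x y; rewrite !f2E.
  by apply: le_trans (min_lipschitz _ _ _) _; exact: ler_dist_dist.
have N0 : (0 <= seminorm f)%E by exact: nonlocal_seminorm_ge0.
have divc D x : ((besov_const D)%:E * x <= seminorm f ->
    x <= ((besov_const D)^-1)%:E * seminorm f)%E.
  move=> h; rewrite muleC lee_pdivlMr ?besov_const_gt0//.
  by rewrite muleC.
have {}E1 := divc _ _ E1; have {}E2 := divc _ _ E2.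
have fin D x : (x <= ((besov_const D)^-1)%:E * seminorm f -> x < +oo)%E.
  move=> /le_lt_trans; apply; apply: lte_mul_pinfty => //.
  by rewrite lee_fin invr_ge0 ltW ?besov_const_gt0.
have dec : sum_decomposition (D0 / (D0 - 2 * s)) (Dinf / (Dinf - 2 * s)) f (f1, f2).
  split => /=.
  - by rewrite inE; apply/andP; split; rewrite inE/= ?inE//; exact: fin E1.
  - by rewrite inE; apply/andP; split; rewrite inE/= ?inE//; exact: fin E2.
  - by apply: nearW => x _ /=; rewrite /f1 subrK.
split; first by exists (f1, f2).
apply: (@le_trans _ _ ('N[mu]_((D0 / (D0 - 2 * s))%:E)[EFin \o f1] +
                       'N[mu]_((Dinf / (Dinf - 2 * s))%:E)[EFin \o f2])%E).
  by apply: ereal_inf_lbound; exists (f1, f2).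
rewrite EFinD ge0_muleDl ?lee_fin ?invr_ge0 ?(ltW (besov_const_gt0 _))//.
exact: (leeD E1 E2).
Qed.

End operator.
End main.

Theorem theorem1p4 (R : realType) (N : nat) (D0 Dinf s gamma : R)
    (hN : (2 <= N)%N) (hs : 0 < s < 1 / 2) (hD : Dinf < D0) (hg : 0 < gamma) :
  exists c ct : R, [/\ 0 < c, 0 < ct &
    forall Q B : 'M[R]_N,
      Q = Q^T -> psdmx Q ->
      (forall t : R, 0 < t -> pdmx (Kmx Q B t)) ->
      0 <= \tr B ->
      dim_zero Q B D0 ->
      dim_infty Q B = Dinf%:E ->
      (forall t : R, 0 < t ->
         gamma * Num.min (t `^ (D0 / 2)) (t `^ (Dinf / 2)) <= vol Q B t) ->
      (forall f : Rn R N -> R, besov Q B (2 * s) 1 f ->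
         sum_space (D0 / (D0 - 2 * s)) (Dinf / (Dinf - 2 * s)) f /\
         (sum_norm (D0 / (D0 - 2 * s)) (Dinf / (Dinf - 2 * s)) f
            <= (c^-1)%:E * besov_seminorm Q B (2 * s) 1 f)%E) /\
      (forall E : set (Rn R N), measurable E ->
         (lebesgue_Rn R N E < +oo)%E ->
         (ct%:E * Order.min (lebesgue_Rn R N E `^ ((D0 - 2 * s) / D0))
                            (lebesgue_Rn R N E `^ ((Dinf - 2 * s) / Dinf))
            <= perimeter Q B s E)%E)].
Proof.
pose K := besov_const N s gamma.
have K0 D : 0 < K D by exact: besov_const_gt0.
(* The norms of the two parts of [f] add up, hence the sum of inverses; an indicator uses only one
   of the two constants, hence the minimum. *)
exists ((K D0)^-1 + (K Dinf)^-1)^-1, (Num.min (K D0) (K Dinf)); split.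
- by rewrite invr_gt0 addr_gt0 ?invr_gt0.
- by rewrite lt_min; apply/andP; split; exact: K0.
move=> Q B symQ _ Kpd trB _ hDinf hV; split => [f Bf|E mE Efin].
  by rewrite invrK; exact: besov_embedding Bf.
exact: isoperimetric.
Qed.
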